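(* Assume $\lim_{n\to\infty}X'X/n=Q$ exists and is positive definite, and let $\beta^{(n)}$ be a sequence in $\mathbb{R}^k$ such that either $\|\sqrt n\beta_2^{(n)}\|\to\infty$ or $\sqrt n\beta_2^{(n)}\to\gamma\in\mathbb{R}^{k_2}$. Let $f_\infty=f_{\infty,\infty}$ in the first case and $f_\infty=f_{\infty,\gamma}$ in the second case. Then $\int_{\mathbb{R}^k}|f_{n,\beta^{(n)},\sigma}(t)-f_\infty(t)|\,dt\to0$ as $n\to\infty$. Consequently the cdf $F_{n,\beta^{(n)},\sigma}(t)=\mathbb{P}_{n,\beta^{(n)},\sigma}(\sqrt n(\tilde\beta-\beta^{(n)})\le t)$ converges in total variation distance to the cdf corresponding to $f_\infty$.
   Context: Setup: for each sample size $n$, $Y=X\beta+u$, where $Y$ is $n\times1$, $X$ is a non-stochastic $n\times k$ matrix of full column rank $k$ (so $n\ge k$), $k>1$, and $u\sim N(0,\sigma^2I_n)$ with $0<\sigma^2<\infty$ known. $\mathbb{P}_{n,\beta,\sigma}$ denotes the distribution of $Y$. Partition $X=[X_1:X_2]$, $\beta=(\beta_1',\beta_2')'$ commensurably, $X_i$ having $k_i\ge1$ columns; $Q$ is partitioned conformably into $Q_{11},Q_{12},Q_{21},Q_{22}$. $\hat\beta(R)=\big(((X_1'X_1)^{-1}X_1'Y)',0_{1\times k_2}\big)'$, $\hat\beta(U)=(X'X)^{-1}X'Y$. For $\alpha>0$, $\tilde\beta=\hat\lambda\hat\beta(R)+(1-\hat\lambda)\hat\beta(U)$ with $\hat\lambda=\big[1+\exp(-2\alpha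 k_2)\exp(\alpha\|X\hat\beta(R)-X\hat\beta(U)\|^2/\sigma^2)\big]^{-1}$. The inequality $\le$ between vectors is componentwise. $f_{n,\beta,\sigma}$ is the Lebesgue density of $\sqrt n(\tilde\beta-\beta)$ under $\mathbb{P}_{n,\beta,\sigma}$ (it exists). $f_{\infty,\infty}$ is the $N(0,\sigma^2Q^{-1})$ density. For $\gamma\in\mathbb{R}^{k_2}$, $f_{\infty,\gamma}$ is the density of $B_\infty\gamma+C_\infty Z_1+[1+\exp(2\alpha k_2)\exp(-\alpha\|Z_2+(Q_{22}-Q_{21}Q_{11}^{-1}Q_{12})^{1/2}\gamma\|^2/\sigma^2)]^{-1}\{D_\infty Z_2-B_\infty\gamma\}$, where $B_\infty=\begin{bmatrix}Q_{11}^{-1}Q_{12}\\-I_{k_2}\end{bmatrix}$, $C_\infty=\begin{bmatrix}Q_{11}^{-1/2}\\0\end{bmatrix}$, $D_\infty=\begin{bmatrix}-Q_{11}^{-1}Q_{12}(Q_{22}-Q_{21}Q_{11}^{-1}Q_{12})^{-1/2}\\(Q_{22}-Q_{21}Q_{11}^{-1}Q_{12})^{-1/2}\end{bmatrix}$, $Z_1\sim N(0,\sigma^2I_{k_1})$ and $Z_2\sim N(0,\sigma^2I_{k_2})$ independent ($A^{1/2}$: symmetric positive definite root). This distribution is absolutely continuous. *)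

(* Defs.v *)
From HB Require Import structures.
From mathcomp Require Import all_boot all_order all_algebra.
From mathcomp Require Import all_classical all_reals all_analysis.
Set Implicit Arguments. Unset Strict Implicit. Unset Printing Implicit Defensive.
Import Order.TTheory GRing.Theory Num.Theory.
Import numFieldNormedType.Exports.
Local Open Scope classical_set_scope.
Local Open Scope ring_scope.

Section Defs.
Variable R : realType.

(* Euclidean space R^m is represented by m.-tuple R, carrying the product
   (Borel) sigma-algebra provided by MathComp-Analysis. *)
Definition Rn (m : nat) := m.-tuple (measurableTypeR R).

(* The Lebesgue integral of a nonnegative function on R^m, computed as the
   iterated one-dimensional Lebesgue integral (Tonelli). *)
Fixpoint leb_int (m : nat) : (Rn m -> \bar R) -> \bar R :=
  match m return (Rn m -> \bar R) -> \bar R with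
  | 0 => fun f => f [tuple]
  | m'.+1 => fun f =>
      (\int[@lebesgue_measure R]_x leb_int (fun t : Rn m' => f (cons_tuple x t)))%E
  end.

Definition tcol (m : nat) (t : Rn m) : 'cV[R]_m := \col_i (tnth t i : R).
Definition ctup (m : nat) (v : 'cV[R]_m) : Rn m := [tuple (v i 0 : measurableTypeR R) | i < m].

Definition enorm (m : nat) (v : 'cV[R]_m) : R := Num.sqrt (\sum_i v i 0 ^+ 2).

Definition gauss_prob (m : nat) (s : R) (E : set (Rn m)) : \bar R :=
  leb_int (fun u : Rn m =>
    ((\1_E u : R) * \prod_(i < m) normal_pdf 0 s (tnth u i))%:E).

Definition is_density (m : nat) (P : set (Rn m) -> \bar R) (f : Rn m -> R) : Prop :=
  measurable_fun setT f /\ (forall t, 0 <= f t) /\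
  forall A : set (Rn m), measurable A ->
    P A = leb_int (fun t => ((\1_A t : R) * f t)%:E).

Definition posdef (m : nat) (A : 'M[R]_m) : Prop :=
  A^T = A /\ forall v : 'cV[R]_m, v != 0 -> 0 < (v^T *m A *m v) 0 0.

Definition sqrtm (m : nat) (A : 'M[R]_m) : 'M[R]_m :=
  xget 0 [set S | posdef S /\ S *m S = A].

Section Estimators.
Variables (k1 k2 n : nat) (X : 'M[R]_(n, k1 + k2)) (s alpha : R).
Definition X1 := lsubmx X.
Definition betaR (Y : 'cV[R]_n) : 'cV[R]_(k1 + k2) :=
  col_mx (invmx (X1^T *m X1) *m X1^T *m Y) 0.
Definition betaU (Y : 'cV[R]_n) : 'cV[R]_(k1 + k2) :=
  invmx (X^T *m X) *m X^T *m Y.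
Definition lambda_hat (Y : 'cV[R]_n) : R :=
  (1 + expR (- (2 * alpha * k2%:R)) *
       expR (alpha * enorm (X *m betaR Y - X *m betaU Y) ^+ 2 / s ^+ 2))^-1.
Definition beta_tilde (Y : 'cV[R]_n) : 'cV[R]_(k1 + k2) :=
  lambda_hat Y *: betaR Y + (1 - lambda_hat Y) *: betaU Y.

Definition law_n (beta : 'cV[R]_(k1 + k2)) (A : set (Rn (k1 + k2))) : \bar R :=
  gauss_prob s [set u : Rn n |
    A (ctup (Num.sqrt (n%:R) *: (beta_tilde (X *m beta + tcol u) - beta)))].
End Estimators.

Section Limits.
Variables (k1 k2 : nat) (Q : 'M[R]_(k1 + k2)) (s alpha : R).
Definition Q11 : 'M[R]_k1 := ulsubmx Q.
Definition Q12 : 'M[R]_(k1, k2) := ursubmx Q.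
Definition Q21 : 'M[R]_(k2, k1) := dlsubmx Q.
Definition Q22 : 'M[R]_k2 := drsubmx Q.
Definition Schur : 'M[R]_k2 := Q22 - Q21 *m invmx Q11 *m Q12.
Definition B_inf : 'M[R]_(k1 + k2, k2) := col_mx (invmx Q11 *m Q12) (- 1%:M).
Definition C_inf : 'M[R]_(k1 + k2, k1) := col_mx (invmx (sqrtm Q11)) 0.
Definition D_inf : 'M[R]_(k1 + k2, k2) :=
  col_mx (- (invmx Q11 *m Q12 *m invmx (sqrtm Schur))) (invmx (sqrtm Schur)).

(* the N(0, s^2 Q^{-1}) density f_{oo,oo} *)
Definition f_inf_inf (t : Rn (k1 + k2)) : R :=
  Num.sqrt (\det Q) / Num.sqrt ((s ^+ 2 * pi *+ 2) ^+ (k1 + k2)) *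
  expR (- ((tcol t)^T *m Q *m tcol t) 0 0 / (s ^+ 2 *+ 2)).

Definition W_gamma (g : 'cV[R]_k2) (z : 'cV[R]_(k1 + k2)) : 'cV[R]_(k1 + k2) :=
  let Z1 := usubmx z in let Z2 := dsubmx z in
  B_inf *m g + C_inf *m Z1 +
  (1 + expR (2 * alpha * k2%:R) *
       expR (- (alpha * enorm (Z2 + sqrtm Schur *m g) ^+ 2 / s ^+ 2)))^-1
    *: (D_inf *m Z2 - B_inf *m g).

Definition law_inf_gamma (g : 'cV[R]_k2) (A : set (Rn (k1 + k2))) : \bar R :=
  gauss_prob s [set z : Rn (k1 + k2) | A (ctup (W_gamma g (tcol z)))].
End Limits.

End Defs.

(* Main.v *)
Require Import Defs.
From HB Require Import structures.
From mathcomp Require Import all_boot all_order all_algebra.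
From mathcomp Require Import all_classical all_reals all_analysis.
From mathcomp Require Import measurable_realfun ring lra complex.
Import Order.TTheory GRing.Theory Num.Theory.
Import numFieldNormedType.Exports.
Local Open Scope classical_set_scope.
Local Open Scope ring_scope.
Set Implicit Arguments. Unset Strict Implicit. Unset Printing Implicit Defensive.

(* Factor [X'X / n = U'U] with [U] block upper triangular and converging to the
   factor of [Q] built from [Q11^(1/2)] and the square root of the Schur complement.
   Then [sqrt n (beta_tilde - beta)] is the image of a standard Gaussian [(z1, z2)]
   under [(z1, z2) |-> U^-1 (z1, h (z2 + c) - c)], where [c] is [sqrt n] times the
   second block of [U beta] and [h v = (1 - lambda) v] is a radial map with
   [1 - lambda] a function of [|v|^2]. In projective coordinates [v = t (1, x)] the
   map [h] acts on [t] alone, so a one-dimensional substitution and Fubini's theorem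
   give its Jacobian [J], hence the explicit density
     |det U| p(y1) p(h^-1 (y2 + c) - c) / J (h^-1 (y2 + c)),   y = U t,
   with [p] the Gaussian density. It converges pointwise, both when [c] converges
   and when [|c|] tends to infinity, because [h v - v] tends to [0] and [J] to [1]
   at infinity. Scheffe's lemma turns this into L1 convergence, and total variation
   convergence follows. *)

(** * Lebesgue measure on R^m *)

(** The estimator and the limit variable both have the form [rlaw], with an invertible [U] and a
    shift [c] as parameters, so the limit theorem becomes continuity of an explicit density in
    [(U, c)], with [c] at infinity as the second case. [U] is block upper triangular because only
    then does the restricted estimator amount to deleting the second block of coordinates. Cholesky
    factors have this shape up to transposition and depend continuously on the matrix, but the limit
    law is written with symmetric roots; a fixed orthogonal matrix reconciles the two. Since [sqrtm]
    is defined by choice, existence of the root has to be proved, through real eigenvectors of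
    symmetric matrices. Projective coordinates are preferred to polar ones because they live on a
    product of Euclidean spaces, so that no measure on the sphere is involved. The inverse of [h]
    has no closed form; it is controlled through the lower bound [(1 + kap)^-1] on the weight, which
    makes it Lipschitz along rays. Finally, the densities in the statement are arbitrary versions
    and must be identified almost everywhere with the explicit ones. *)

Section sigma_finite_pushforward.
Context d1 d2 (X : measurableType d1) (Y : measurableType d2) (R : realType).
Variables (mu : {sigma_finite_measure set X -> \bar R}) (f : X -> Y) (g : Y -> X).
Hypotheses (mf : measurable_fun setT f) (mg : measurable_fun setT g).
Hypothesis fK : cancel f g.

(** The left inverse [g] provides sigma-finiteness: since [g \o f = id], pulling an exhaustion of
    [X] back along [g] gives sets with the same finite measures. *)
Definition push_sf : set Y -> \bar R := pushforward mu f.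

Let push_sf0 : push_sf set0 = 0%E.
Proof. by rewrite /push_sf /pushforward preimage_set0 measure0. Qed.

Let push_sf_ge0 A : (0 <= push_sf A)%E.
Proof. exact: measure_ge0. Qed.

Let push_sf_sigma_additive : semi_sigma_additive push_sf.
Proof.
exact: (@measure_semi_sigma_additive _ _ _ (pushforward mu f)).
Qed.

HB.instance Definition _ := isMeasure.Build _ _ _ push_sf push_sf0 push_sf_ge0
  push_sf_sigma_additive.

Let push_sf_sigma_finite : sigma_finite setT push_sf.
Proof.
have [F TF Foo] := sigma_finiteT mu.
exists (fun n => g @^-1` F n).
  by rewrite -preimage_bigcup -TF preimage_setT.
move=> n; have [mFn muFn] := Foo n; split.
  by rewrite -[X in measurable X]setTI; exact: mg.
by rewrite /push_sf /pushforward -comp_preimage (_ : g \o f = id) //; apply/funext => x /=.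
Qed.

HB.instance Definition _ := Measure_isSigmaFinite.Build _ _ _ push_sf push_sf_sigma_finite.

Definition push_sfm : {sigma_finite_measure set Y -> \bar R} := push_sf.

End sigma_finite_pushforward.

Definition ptcons (R : realType) (m : nat) (p : measurableTypeR R * Rn R m) :
  Rn R m.+1 := cons_tuple p.1 p.2.

Definition ptuncons (R : realType) (m : nat) (t : Rn R m.+1) :
  measurableTypeR R * Rn R m := (tnth t ord0, [tuple of behead t]).

Lemma measurable_ptcons (R : realType) m : measurable_fun setT (@ptcons R m).
Proof. by apply: measurable_cons; [exact: measurable_fst|exact: measurable_snd]. Qed.

Lemma measurable_ptuncons (R : realType) m : measurable_fun setT (@ptuncons R m).
Proof. by apply/measurable_fun_pair; [exact: measurable_tnth|exact: measurable_behead]. Qed.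

Lemma ptconsK (R : realType) m : cancel (@ptcons R m) (@ptuncons R m).
Proof. by case=> x t; rewrite /ptuncons /ptcons/=; congr pair; exact/val_inj. Qed.

(* A copy of [\x] under a new name: canonical structure inference for [\x]
   itself only finds sub-probabilities, not sigma-finite measures. *)
Definition prodm d1 d2 (X : measurableType d1) (Y : measurableType d2) (R : realType)
    (mu : {sigma_finite_measure set X -> \bar R})
    (nu : {sigma_finite_measure set Y -> \bar R}) :
  set (X * Y)%type -> \bar R := (mu \x nu)%E.

HB.instance Definition _ d1 d2 (X : measurableType d1) (Y : measurableType d2)
    (R : realType) (mu : {sigma_finite_measure set X -> \bar R})
    (nu : {sigma_finite_measure set Y -> \bar R}) :=
  Measure.copy (prodm mu nu) (mu \x nu)%E.

Lemma prodm_sigma_finite d1 d2 (X : measurableType d1) (Y : measurableType d2)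
    (R : realType) (mu : {sigma_finite_measure set X -> \bar R})
    (nu : {sigma_finite_measure set Y -> \bar R}) : sigma_finite setT (prodm mu nu).
Proof.
have /sigma_finiteP[F [FT Fnd Foo]] := sigma_finiteT mu.
have /sigma_finiteP[G [GT Gnd Goo]] := sigma_finiteT nu.
exists (fun n => F n `*` G n).
  apply/esym; rewrite -subTset => -[x y] _.
  have [i _ Fx] : (\bigcup_i F i) x by rewrite -FT.
  have [j _ Gy] : (\bigcup_i G i) y by rewrite -GT.
  exists (maxn i j) => //; split => /=.
    by have /subsetPset := Fnd _ _ (leq_maxl i j); exact.
  by have /subsetPset := Gnd _ _ (leq_maxr i j); exact.
move=> n; have [mF muF] := Foo n; have [mG nuG] := Goo n.
split; first exact: measurableX.
by rewrite /prodm product_measure1E// lte_mul_pinfty// ge0_fin_numE.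
Qed.

HB.instance Definition _ d1 d2 (X : measurableType d1) (Y : measurableType d2)
    (R : realType) (mu : {sigma_finite_measure set X -> \bar R})
    (nu : {sigma_finite_measure set Y -> \bar R}) :=
  Measure_isSigmaFinite.Build _ _ _ (prodm mu nu) (prodm_sigma_finite mu nu).

Definition lebcons (R : realType) (m : nat)
    (nu : {sigma_finite_measure set (Rn R m) -> \bar R}) :
    {sigma_finite_measure set (Rn R m.+1) -> \bar R} :=
  push_sfm (prodm (@lebesgue_measure R) nu) (@measurable_ptcons R m)
    (@measurable_ptuncons R m) (@ptconsK R m).

(** A genuine measure behind the iterated integral [leb_int], so that Fubini and the convergence
    theorems apply. The point mass in dimension 0 matches the base case of [leb_int]. *)
Fixpoint lebn (R : realType) (m : nat) : {sigma_finite_measure set (Rn R m) -> \bar R} :=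
  if m is m'.+1 return {sigma_finite_measure set (Rn R m) -> \bar R}
  then lebcons (lebn R m') else \d_([tuple] : Rn R 0).

Lemma ge0_integral_lebn (R : realType) m (f : Rn R m.+1 -> \bar R) :
  measurable_fun setT f -> (forall t, 0 <= f t)%E ->
  (\int[lebn R m.+1]_t f t =
   \int[(@lebesgue_measure R \x lebn R m)%E]_p f (ptcons p))%E.
Proof.
move=> mf f0.
rewrite /= /lebcons.
by rewrite (@ge0_integral_pushforward _ _ _ _ _ _ (@measurable_ptcons R m) _ setT f).
Qed.

Lemma leb_intE (R : realType) m (f : Rn R m -> \bar R) :
  measurable_fun setT f -> (forall t, 0 <= f t)%E ->
  leb_int f = (\int[lebn R m]_t f t)%E.
Proof.
elim: m f => [|m IH] f mf f0.
  by rewrite /= integral_dirac //= diracE in_setT mul1e.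
rewrite ge0_integral_lebn // fubini_tonelli1 //=; last first.
  by apply: (measurableT_comp mf); exact: measurable_ptcons.
apply: eq_integral => x _; rewrite IH //.
apply: (measurableT_comp mf).
by apply: measurable_cons; [exact: measurable_cst|exact: measurable_id].
Qed.

(* Linear algebra takes place on column vectors and measure theory on tuples:
   functions of columns are measured and integrated through [tcol]. *)
Definition mcol (R : realType) m d (T : measurableType d) (F : 'cV[R]_m -> T) :=
  measurable_fun setT (fun t : Rn R m => F (tcol t)).

Definition mmap (R : realType) m p (f : 'cV[R]_m -> 'cV[R]_p) :=
  forall i, mcol (fun v => f v i 0 : measurableTypeR R).

Definition colint (R : realType) m (F : 'cV[R]_m -> \bar R) : \bar R :=
  (\int[lebn R m]_t F (tcol t))%E.

Definition ccons (R : realType) m (x : R) (v : 'cV[R]_m) : 'cV[R]_m.+1 :=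
  col_mx (x%:M : 'M[R]_1) v.

Lemma tcolK (R : realType) m : cancel (@tcol R m) (@ctup R m).
Proof. by move=> t; apply: eq_from_tnth => i; rewrite tnth_mktuple mxE. Qed.

Lemma ctupK (R : realType) m : cancel (@ctup R m) (@tcol R m).
Proof. by move=> v; apply/colP => i; rewrite mxE tnth_mktuple. Qed.

Lemma ccons0 (R : realType) m (x : R) (v : 'cV[R]_m) : ccons x v ord0 0 = x.
Proof.
have -> : ord0 = lshift m (ord0 : 'I_1) :> 'I_m.+1 by exact/val_inj.
by apply: (etrans (col_mxEu (x%:M : 'M[R]_1) v _ _)); rewrite mxE eqxx mulr1n.
Qed.

Lemma cconsS (R : realType) m (x : R) (v : 'cV[R]_m) i : ccons x v (lift ord0 i) 0 = v i 0.
Proof.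
have -> : lift ord0 i = rshift 1 i :> 'I_m.+1 by exact/val_inj.
exact: (col_mxEd (x%:M : 'M[R]_1)).
Qed.

Lemma cconsP (R : realType) m (v : 'cV[R]_m.+1) : exists x w, v = ccons x w.
Proof.
exists (v ord0 0), (\col_i v (lift ord0 i) 0); apply/colP => i.
by case: (unliftP ord0 i) => [j|] ->; rewrite ?cconsS ?ccons0 ?mxE.
Qed.

Lemma tcol_cons (R : realType) m (x : R) (t : Rn R m) :
  tcol (cons_tuple x t : Rn R m.+1) = ccons x (tcol t).
Proof.
apply/colP => i; case: (unliftP ord0 i) => [j|] ->.
  by rewrite cconsS !mxE tnthS.
by rewrite ccons0 mxE tnth0.
Qed.

Lemma mcol_measurable (R : realType) m d (T : measurableType d) (f : Rn R m -> T) :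
  measurable_fun setT f -> mcol (fun v => f (ctup v)).
Proof. by move=> mf; rewrite /mcol; under eq_fun do rewrite tcolK. Qed.

Lemma measurable_ctup (R : realType) m p (f : 'cV[R]_m -> 'cV[R]_p) :
  mmap f -> measurable_fun setT (fun t : Rn R m => ctup (f (tcol t))).
Proof.
move=> mf; apply/measurable_fun_tnthP => i.
have := mf i; apply: eq_measurable_fun => t _ /=.
by rewrite tnth_mktuple.
Qed.

Lemma mcol_comp (R : realType) m p d (T : measurableType d) (F : 'cV[R]_p -> T)
  (f : 'cV[R]_m -> 'cV[R]_p) : mcol F -> mmap f -> mcol (fun v => F (f v)).
Proof.
move=> mF /measurable_ctup mf; have := measurableT_comp mF mf.
by apply: eq_measurable_fun => t _ /=; rewrite ctupK.
Qed.

Lemma mmap_comp (R : realType) m p q (g : 'cV[R]_p -> 'cV[R]_q)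
  (f : 'cV[R]_m -> 'cV[R]_p) : mmap g -> mmap f -> mmap (fun v => g (f v)).
Proof. by move=> mg mf i; exact: (mcol_comp (mg i)). Qed.

Lemma mmap_id (R : realType) m : mmap (@id 'cV[R]_m).
Proof.
move=> i; have := @measurable_tnth _ (measurableTypeR R) m i.
by apply: eq_measurable_fun => t _; rewrite mxE.
Qed.

Lemma mmap_cst (R : realType) m p (c : 'cV[R]_p) : mmap (fun _ : 'cV[R]_m => c).
Proof. by move=> i; exact: measurable_cst. Qed.

Lemma mmapD (R : realType) m p (f g : 'cV[R]_m -> 'cV[R]_p) :
  mmap f -> mmap g -> mmap (fun v => f v + g v).
Proof.
move=> mf mg i; have := measurable_funD (mf i) (mg i).
by apply: eq_measurable_fun => t _; rewrite mxE.
Qed.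

Lemma mmapZ (R : realType) m p (h : 'cV[R]_m -> R) (f : 'cV[R]_m -> 'cV[R]_p) :
  mcol (h : _ -> measurableTypeR R) -> mmap f -> mmap (fun v => h v *: f v).
Proof.
move=> mh mf i; have := measurable_funM mh (mf i).
by apply: eq_measurable_fun => t _; rewrite mxE.
Qed.

Lemma mmap_mulmx (R : realType) m p q (A : 'M[R]_(q, p)) (f : 'cV[R]_m -> 'cV[R]_p) :
  mmap f -> mmap (fun v => A *m f v).
Proof.
move=> mf i; rewrite /mcol; under eq_fun do rewrite mxE.
apply: measurable_sum => j; apply: measurable_funM; first exact: measurable_cst.
exact: mf.
Qed.

Lemma mmap_col_mx (R : realType) m p q (f : 'cV[R]_m -> 'cV[R]_p)
  (g : 'cV[R]_m -> 'cV[R]_q) : mmap f -> mmap g -> mmap (fun v => col_mx (f v) (g v)).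
Proof.
move=> mf mg i; case: (split_ordP i) => j ->.
  by have := mf j; apply: eq_measurable_fun => t _; rewrite col_mxEu.
by have := mg j; apply: eq_measurable_fun => t _; rewrite col_mxEd.
Qed.

Lemma mmap_usubmx (R : realType) m p q (f : 'cV[R]_m -> 'cV[R]_(p + q)) :
  mmap f -> mmap (fun v => usubmx (f v)).
Proof. by move=> mf i; rewrite /mcol; under eq_fun do rewrite mxE; exact: mf. Qed.

Lemma mmap_dsubmx (R : realType) m p q (f : 'cV[R]_m -> 'cV[R]_(p + q)) :
  mmap f -> mmap (fun v => dsubmx (f v)).
Proof. by move=> mf i; rewrite /mcol; under eq_fun do rewrite mxE; exact: mf. Qed.

Lemma mmap_ccons (R : realType) m p (h : 'cV[R]_m -> R) (f : 'cV[R]_m -> 'cV[R]_p) :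
  mcol (h : _ -> measurableTypeR R) -> mmap f -> mmap (fun v => ccons (h v) (f v)).
Proof.
move=> mh mf i; case: (unliftP ord0 i) => [j|] ->.
  by have := mf j; apply: eq_measurable_fun => t _; rewrite cconsS.
by apply: eq_measurable_fun mh => t _; rewrite ccons0.
Qed.

Lemma colint_leb_int (R : realType) m (F : 'cV[R]_m -> \bar R) :
  mcol F -> (forall v, 0 <= F v)%E -> colint F = leb_int (fun t => F (tcol t)).
Proof. by move=> mF F0; rewrite leb_intE. Qed.

Lemma eq_colint (R : realType) m (F G : 'cV[R]_m -> \bar R) : F =1 G -> colint F = colint G.
Proof. by move=> FG; apply: eq_integral => t _; rewrite FG. Qed.

Lemma colint_ge0 (R : realType) m (F : 'cV[R]_m -> \bar R) :
  (forall v, 0 <= F v)%E -> (0 <= colint F)%E.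
Proof. by move=> F0; exact: integral_ge0. Qed.

Section colint_cons.
Variables (R : realType) (m : nat) (F : 'cV[R]_m.+1 -> \bar R).
Hypotheses (mF : mcol F) (F0 : forall v, (0 <= F v)%E).

Let f (p : measurableTypeR R * Rn R m) : \bar R := F (ccons p.1 (tcol p.2)).

Let f0 t : (0 <= f t)%E. Proof. exact: F0. Qed.

Let mf : measurable_fun setT f.
Proof.
have := measurableT_comp mF (@measurable_ptcons R m).
by apply: eq_measurable_fun => -[x t] _ /=; rewrite tcol_cons.
Qed.

Let colintE : colint F = (\int[@lebesgue_measure R \x lebn R m]_p f p)%E.
Proof.
rewrite /colint ge0_integral_lebn //; apply: eq_integral => -[x t] _.
by rewrite /ptcons tcol_cons.
Qed.

Lemma colint_cons : colint F = (\int[@lebesgue_measure R]_x colint (fun v => F (ccons x v)))%E.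
Proof. by rewrite colintE (fubini_tonelli1 (m1 := @lebesgue_measure R) (m2 := lebn R m) f mf f0). Qed.

(** The order of integration used when the first coordinate is transformed at fixed values of the
    others. *)
Lemma colint_cons_swap : colint F = colint (fun v => (\int[@lebesgue_measure R]_x F (ccons x v))%E).
Proof. by rewrite colintE (fubini_tonelli2 (m1 := @lebesgue_measure R) (m2 := lebn R m) f mf f0). Qed.

Lemma mcol_int : mcol (fun v => (\int[@lebesgue_measure R]_x F (ccons x v))%E).
Proof. exact: (measurable_fun_fubini_tonelli_G (m1 := @lebesgue_measure R) f mf f0). Qed.

Lemma measurable_colint :
  measurable_fun setT (fun x : measurableTypeR R => colint (fun v => F (ccons x v))).
Proof. exact: (measurable_fun_fubini_tonelli_F (m2 := lebn R m) f mf f0). Qed.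

Lemma measurable_ccons v : measurable_fun setT (fun x : measurableTypeR R => F (ccons x v)).
Proof.
have := measurableT_comp mf (@pair2_measurable _ _ (measurableTypeR R) (Rn R m) (ctup v)).
by apply: eq_measurable_fun => x _ /=; rewrite /f/= ctupK.
Qed.

Lemma mcol_ccons x : mcol (fun v => F (ccons x v)).
Proof. exact: (measurableT_comp mf (@pair1_measurable _ _ (measurableTypeR R) (Rn R m) x)). Qed.

End colint_cons.

(** Both sides unfold to the same iterated one-dimensional integral; this is bookkeeping on tuples
    rather than an instance of Fubini. *)
Lemma leb_int_cat (R : realType) p q (f : Rn R (p + q) -> \bar R) :
  leb_int f = leb_int (fun a : Rn R p => leb_int (fun b : Rn R q => f (cat_tuple a b))).
Proof.
elim: p f => [|p IH] f /=.
  by congr leb_int; apply/funext => b; congr f; exact/val_inj.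
apply: eq_integral => x _; rewrite IH; congr leb_int.
apply/funext => a; congr leb_int; apply/funext => b; congr f; exact/val_inj.
Qed.

Lemma tcol_cat (R : realType) p q (a : Rn R p) (b : Rn R q) :
  tcol (cat_tuple a b : Rn R (p + q)) = col_mx (tcol a) (tcol b).
Proof.
apply/colP => i; case: (split_ordP i) => j ->.
  by rewrite col_mxEu !mxE tnth_lshift.
by rewrite col_mxEd !mxE tnth_rshift.
Qed.

Section colint_cat.
Variables (R : realType) (p q : nat) (F : 'cV[R]_(p + q) -> \bar R).
Hypotheses (mF : mcol F) (F0 : forall v, (0 <= F v)%E).

Let f (t : Rn R p * Rn R q) : \bar R := F (col_mx (tcol t.1) (tcol t.2)).

Let f0 t : (0 <= f t)%E. Proof. exact: F0. Qed.

Let mf : measurable_fun setT f.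
Proof.
have mc : measurable_fun setT (fun t : Rn R p * Rn R q => cat_tuple t.1 t.2 : Rn R (p + q)).
  apply/measurable_fun_tnthP => i; case: (split_ordP i) => j ->.
    apply: (eq_measurable_fun (fun t : Rn R p * Rn R q => tnth t.1 j)).
      by move=> t _ /=; rewrite tnth_lshift.
    exact: measurableT_comp (measurable_tnth j) measurable_fst.
  apply: (eq_measurable_fun (fun t : Rn R p * Rn R q => tnth t.2 j)).
    by move=> t _ /=; rewrite tnth_rshift.
  exact: measurableT_comp (measurable_tnth j) measurable_snd.
have := measurableT_comp mF mc.
by apply: eq_measurable_fun => -[a b] _ /=; rewrite tcol_cat.
Qed.

Lemma mcol_colint : mcol (fun a => colint (fun b => F (col_mx a b))).
Proof. exact: (measurable_fun_fubini_tonelli_F (m2 := lebn R q) f mf f0). Qed.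

Lemma mcol_col_mx a : mcol (fun b => F (col_mx a b)).
Proof.
have := measurableT_comp mf (@pair1_measurable _ _ (Rn R p) (Rn R q) (ctup a)).
by apply: eq_measurable_fun => t _ /=; rewrite /f/= ctupK.
Qed.

Lemma colint_cat : colint F = colint (fun a => colint (fun b => F (col_mx a b))).
Proof.
rewrite colint_leb_int // leb_int_cat [RHS]colint_leb_int //; last 2 first.
- exact: mcol_colint.
- by move=> v; exact: colint_ge0.
congr leb_int; apply/funext => a.
rewrite colint_leb_int //; last exact: mcol_col_mx.
by congr leb_int; apply/funext => b; rewrite tcol_cat.
Qed.

End colint_cat.

(** * Changes of variables *)

Section substitution.
Variables (R : realType) (phi dphi : R -> R).
Local Notation mu := (@lebesgue_measure R).
Hypotheses (phi_mono : {mono phi : x y / x <= y})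
  (phi_surj : forall y, exists x, phi x = y)
  (phi_drv : forall x, is_derive x (1 : R) phi (dphi x))
  (dphi_cont : continuous dphi) (dphi_ge0 : forall x, 0 <= dphi x).

Let phi_cont : continuous phi.
Proof.
move=> x; apply: differentiable_continuous; apply/derivable1_diffP.
by have [] := phi_drv x.
Qed.

Let phi_meas : measurable_fun setT (phi : measurableTypeR R -> measurableTypeR R).
Proof. exact: continuous_measurable_fun. Qed.

Let dphi_meas : measurable_fun setT (dphi : measurableTypeR R -> measurableTypeR R).
Proof. exact: continuous_measurable_fun. Qed.

Let phi_pre (E : set (measurableTypeR R)) : measurable E -> measurable (phi @^-1` E).
Proof. by move=> mE; rewrite -[X in measurable X]setTI; exact: phi_meas. Qed.

Let nu (E : set (measurableTypeR R)) : \bar R := (\int[mu]_(x in phi @^-1` E) (dphi x)%:E)%E.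

Let nu0 : nu set0 = 0%E. Proof. by rewrite /nu preimage_set0 integral_set0. Qed.

Let nu_ge0 E : (0 <= nu E)%E.
Proof. by apply: integral_ge0 => x _; rewrite lee_fin. Qed.

Let nu_sigma_additive : semi_sigma_additive nu.
Proof.
move=> F mF tF mUF; rewrite /nu preimage_bigcup ge0_integral_bigcup //.
- apply: is_cvg_ereal_nneg_natsum_cond => n _ _; exact: nu_ge0.
- by move=> n; exact: phi_pre.
- by apply/measurable_EFinP; exact: measurable_funTS.
- by move=> x _; rewrite lee_fin.
- apply/trivIsetP => i j _ _ ij; rewrite -preimage_setI.
  by move/trivIsetP : tF => /(_ _ _ _ _ ij) ->//; rewrite preimage_set0.
Qed.

HB.instance Definition _ := isMeasure.Build _ _ _ nu nu0 nu_ge0 nu_sigma_additive.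

Let phi_lt : {mono phi : x y / x < y}.
Proof. exact: leW_mono. Qed.

(** On []a, b]] this is the fundamental theorem of calculus, because [phi] is an increasing
    bijection and pulls the interval back to an interval; uniqueness of Lebesgue measure does the
    rest. *)
Let nu_leb (E : set (measurableTypeR R)) : measurable E -> mu E = nu E.
Proof.
apply: lebesgue_measure_unique => _ [[a b] _ <-] /=.
rewrite lebesgue_measure_itv /= lte_fin.
have [a' ea] := phi_surj a; have [b' eb] := phi_surj b.
rewrite /nu (_ : phi @^-1` _ = `]a', b']%classic); last first.
  apply/seteqP; split=> x /=; rewrite !in_itv /= -ea -eb phi_mono phi_lt //.
rewrite -ea -eb phi_lt; case: ltP => ab; last first.
  by rewrite set_itv_ge ?integral_set0// bnd_simp -leNgt.
rewrite integral_itv_obnd_cbnd; last first.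
  by apply/measurable_funTS/measurable_EFinP.
rewrite (@continuous_FTC2 _ _ phi) //.
- exact: continuous_subspaceT.
- split.
  + by move=> x _; have [] := phi_drv x.
  + exact/cvg_at_right_filter/phi_cont.
  + exact/cvg_at_left_filter/phi_cont.
- by move=> x _; rewrite derive1E; have [_ ->] := phi_drv x.
Qed.

Import HBNNSimple.

Let subst_nnsfun (h : {nnsfun measurableTypeR R >-> R}) :
  (\int[mu]_y (h y)%:E = \int[mu]_x ((h (phi x))%:E * (dphi x)%:E))%E.
Proof.
transitivity (\int[mu]_y (\sum_(k \in range h) (k * \1_(h @^-1` [set k]) y)%:E))%E.
  by apply: eq_integral => y _; rewrite fsumEFin// -fimfunE.
rewrite ge0_integral_fsum//; last 2 first.
- by move=> k; exact/measurable_EFinP/measurable_funM.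
- by move=> k y _; rewrite nnfun_muleindic_ge0.
transitivity (\sum_(k \in range h) \int[mu]_x ((k * \1_(h @^-1` [set k]) (phi x))%:E * (dphi x)%:E))%E.
  apply: eq_fsbigr => k /set_mem [y0 _ <-].
  rewrite integralZl_indic_nnsfun// integral_indic// setIT.
  transitivity ((h y0)%:E * nu (h @^-1` [set h y0]))%E.
    by congr (_ * _)%E; exact: nu_leb.
  rewrite /nu.
  under [RHS]eq_integral do rewrite -EFinM -mulrA EFinM.
  rewrite ge0_integralZl_EFin//; last 2 first.
  - by move=> x _; rewrite lee_fin mulr_ge0.
  - apply/measurable_EFinP/measurable_funM => //.
    by apply: (measurableT_comp (measurable_indic _)) => //; exact: measurable_sfunP.
  congr (_ * _)%E; rewrite [LHS]integral_mkcond; apply: eq_integral => x _.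
  rewrite /patch indicE; case: ifPn => xA.
    by rewrite mem_set ?mul1r//; move: xA => /set_mem.
  rewrite memNset ?mul0r// => xB; move/negP : xA; apply; exact/mem_set.
rewrite -ge0_integral_fsum//; last 2 first.
- move=> k; apply: emeasurable_funM; last exact/measurable_EFinP.
  apply/measurable_EFinP/measurable_funM => //.
  by apply: (measurableT_comp (measurable_indic _)) => //; exact: measurable_sfunP.
- by move=> k x _; apply: mule_ge0; rewrite ?lee_fin// -lee_fin EFinM nnfun_muleindic_ge0.
apply: eq_integral => x _; rewrite -ge0_mule_fsuml.
  by rewrite fsumEFin// -fimfunE.
by move=> k; rewrite EFinM nnfun_muleindic_ge0.
Qed.

(** [nu_leb] is the case of indicators; linearity gives simple functions and monotone convergence
    gives the general integrand. *)
Lemma substitution (F : measurableTypeR R -> \bar R) :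
  measurable_fun setT F -> (forall x, 0 <= F x)%E ->
  (\int[mu]_y F y = \int[mu]_x (F (phi x) * (dphi x)%:E))%E.
Proof.
move=> mF F0; pose h := nnsfun_approx measurableT mF.
transitivity (limn (fun n => \int[mu]_y (h n y)%:E))%E.
  rewrite -monotone_convergence//.
  - by apply: eq_integral => y _; apply/esym/cvg_lim => //; apply: cvg_nnsfun_approx.
  - by move=> n; exact/measurable_EFinP.
  - by move=> n y _; rewrite lee_fin.
  - by move=> y _ m n mn; rewrite lee_fin; exact/lefP/nd_nnsfun_approx.
under eq_fun do rewrite subst_nnsfun.
rewrite -monotone_convergence//.
- apply: eq_integral => x _; apply/cvg_lim => //.
  apply: cvgeZr => //.
  exact: cvg_nnsfun_approx.
- move=> n; apply: emeasurable_funM; last exact/measurable_EFinP.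
  by apply/measurable_EFinP; apply: (measurableT_comp (f := (h n : _ -> R))).
- by move=> n x _; rewrite mule_ge0 ?lee_fin.
- move=> x _ m n mn; apply: lee_wpmul2r; first by rewrite lee_fin.
  by rewrite lee_fin; have /lefP := nd_nnsfun_approx measurableT mF mn; exact.
Qed.

End substitution.

Lemma colintZl (R : realType) m (F : 'cV[R]_m -> \bar R) (k : R) :
  mcol F -> (forall v, 0 <= F v)%E -> 0 <= k ->
  colint (fun v => k%:E * F v)%E = (k%:E * colint F)%E.
Proof. by move=> mF F0 k0; rewrite /colint ge0_integralZl_EFin. Qed.

Lemma integral_opp (R : realType) (F : measurableTypeR R -> \bar R) :
  measurable_fun setT F -> (forall x, 0 <= F x)%E ->
  (\int[@lebesgue_measure R]_x F (- x)%R = \int[@lebesgue_measure R]_x F x)%E.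
Proof.
move=> mF F0.
have mN : measurable_fun setT (-%R : measurableTypeR R -> measurableTypeR R).
  by apply: continuous_measurable_fun; exact: opp_continuous.
rewrite -[LHS](@ge0_integral_pushforward _ _ _ _ _ _ mN _ setT F) //.
by apply: eq_measure_integral => A mA _; exact: lebesgue_measureN.
Qed.

Lemma integral_affine (R : realType) (a b : R) (F : measurableTypeR R -> \bar R) :
  a != 0 -> measurable_fun setT F -> (forall x, 0 <= F x)%E ->
  (`|a|%:E * \int[@lebesgue_measure R]_x F (a * x + b)%R = \int[@lebesgue_measure R]_x F x)%E.
Proof.
have aff_meas (c d : R) : measurable_fun setT
    ((fun x => c * x + d) : measurableTypeR R -> measurableTypeR R).
  apply: measurable_funD => //; apply: measurable_funM => //.
have pos (c d : R) (G : measurableTypeR R -> \bar R) :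
  0 < c -> measurable_fun setT G -> (forall x, 0 <= G x)%E ->
  (c%:E * \int[@lebesgue_measure R]_x G (c * x + d)%R = \int[@lebesgue_measure R]_x G x)%E.
  move=> c0 mG G0; rewrite [RHS](@substitution _ (fun x => c * x + d) (fun=> c)) //.
  - rewrite -ge0_integralZl_EFin ?ltW//.
      by apply: eq_integral => x _; rewrite muleC.
    exact: (measurableT_comp mG (aff_meas c d)).
  - by move=> x y; rewrite lerD2r ler_pM2l.
  - by move=> y; exists (c^-1 * (y - d)); rewrite mulrA divff ?gt_eqF// mul1r subrK.
  - by move=> x; apply: is_derive_eq; rewrite addr0 /GRing.scale/= mulr1.
  - by move=> x; exact: cvg_cst.
  - by move=> _; exact: ltW.
move=> a0 mF F0; have [an|ap|a00] := ltgtP a 0; last by rewrite a00 eqxx in a0.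
(* A negative slope is reduced to the positive slope [- a] by reflecting the integrand. *)
- rewrite -[RHS]integral_opp // -[RHS](pos (- a) (- b) (fun x => F (- x)%R)) ?oppr_gt0//.
    rewrite ltr0_norm//; congr (_ * _)%E; apply: eq_integral => x _.
    by rewrite opprD mulNr !opprK.
  have mN : measurable_fun setT (-%R : measurableTypeR R -> measurableTypeR R).
    by apply: continuous_measurable_fun; exact: opp_continuous.
  exact: (measurableT_comp mF mN).
- by rewrite gtr0_norm// pos.
Qed.

Lemma colint_shift (R : realType) m (b : 'cV[R]_m) (F : 'cV[R]_m -> \bar R) :
  mcol F -> (forall v, 0 <= F v)%E -> colint (fun v => F (v + b)) = colint F.
Proof.
elim: m b F => [|m IH] b F mF F0.
  by apply: eq_colint => v; rewrite [v + b]flatmx0 [v]flatmx0.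
have [c [d ->]] := cconsP b.
have addE x v : ccons x v + ccons c d = ccons (x + c) (v + d) :> 'cV[R]_m.+1.
  apply/colP => i; rewrite [LHS]mxE.
  by case: (unliftP ord0 i) => [j|] ->; rewrite ?ccons0 // !cconsS mxE.
have mD : mmap (fun v : 'cV[R]_m.+1 => v + ccons c d).
  by apply: mmapD; [exact: mmap_id|exact: mmap_cst].
rewrite colint_cons //; last exact: (mcol_comp mF mD).
transitivity (\int[@lebesgue_measure R]_x colint (fun v => F (ccons (1 * x + c) v)))%E.
  apply: eq_integral => x _; rewrite -[RHS](IH d) //; last exact: mcol_ccons.
  by apply: eq_colint => v; rewrite addE mul1r.
rewrite -[LHS]mul1e -[X in (X%:E * _)%E]normr1.
rewrite (@integral_affine _ _ _ (fun x => colint (fun v => F (ccons x v)))) ?oner_neq0 //.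
- by rewrite -colint_cons.
- exact: measurable_colint.
- by move=> x; exact: colint_ge0.
Qed.

(** A predicate on matrices because the property is closed under products, which reduces invertible
    matrices to triangular factors. *)
Definition lin_change (R : realType) m (A : 'M[R]_m) := forall F : 'cV[R]_m -> \bar R,
  mcol F -> (forall v, 0 <= F v)%E ->
  (`|\det A|%:E * colint (fun v => F (A *m v)) = colint F)%E.

Lemma lin_change_mul (R : realType) m (A B : 'M[R]_m) : lin_change A -> lin_change B -> lin_change (A *m B).
Proof.
move=> cA cB F mF F0; have mA := mmap_mulmx A (@mmap_id R m).
rewrite -[RHS]cA // -(cB (fun v => F (A *m v))) //; last exact: (mcol_comp mF mA).
rewrite muleA -EFinM -normrM -det_mulmx; congr (_ * _)%E.
by apply: eq_colint => v; rewrite mulmxA.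
Qed.

(** The splitting of the index set as [1 + m], typed with [m.+1] and with a scalar corner, so that
    inductions on the dimension run without casts. *)
Definition cblock (R : realType) m (a : R) (b : 'rV[R]_m) (c : 'cV[R]_m) (D : 'M[R]_m) :
  'M[R]_m.+1 := block_mx (a%:M : 'M[R]_1) b c D.

Lemma cblock_ccons (R : realType) m (a : R) b c (D : 'M[R]_m) x (v : 'cV[R]_m) :
  cblock a b c D *m ccons x v = ccons (a * x + (b *m v) 0 0) (D *m v + x *: c).
Proof.
apply: (etrans (mul_block_col (a%:M : 'M[R]_1) b c D (x%:M : 'M[R]_1) v)).
rewrite /ccons; congr (@col_mx _ 1 m 1 _ _).
  by rewrite raddfD /= -scalar_mxM -mx11_scalar.
by rewrite mul_mx_scalar addrC.
Qed.

Lemma det_cblock_upper (R : realType) m (a : R) b (D : 'M[R]_m) :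
  \det (cblock a b 0 D) = a * \det D.
Proof. by have := det_ublock (a%:M : 'M[R]_1) b D; rewrite det_scalar1. Qed.

Lemma det_cblock_lower (R : realType) m (c : 'cV[R]_m) : \det (cblock 1 0 c 1%:M) = 1.
Proof. by have := det_lblock (1%:M : 'M[R]_1) c 1%:M; rewrite !det1 mulr1. Qed.

(** At a fixed tail [v] the head undergoes the affine map [x |-> a x + b v]; once the head is
    integrated out, only [D] acts on the tail. *)
Lemma lin_change_upper (R : realType) m (a : R) b (D : 'M[R]_m) : a != 0 -> lin_change D -> lin_change (cblock a b 0 D).
Proof.
move=> a0 cD F mF F0.
rewrite det_cblock_upper; have mc := mmap_mulmx (cblock a b 0 D) (@mmap_id R m.+1).
have mFc := mcol_comp mF mc.
rewrite colint_cons_swap // mulrC normrM EFinM -muleA -colintZl //; last 2 first.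
- exact: (mcol_int mFc (fun v => F0 _)).
- by move=> v; exact: integral_ge0.
transitivity (`|\det D|%:E * colint (fun v => (\int[@lebesgue_measure R]_x F (ccons x (D *m v)))%E))%E.
  congr (_ * _)%E; apply: eq_colint => v.
  rewrite -[RHS](@integral_affine _ a ((b *m v) 0 0)) //; last exact: measurable_ccons.
  by congr (_ * _)%E; apply: eq_integral => x _; rewrite cblock_ccons scaler0 addr0.
rewrite (cD (fun v => (\int[@lebesgue_measure R]_x F (ccons x v))%E)).
- by rewrite -colint_cons_swap.
- exact: mcol_int.
- by move=> v; exact: integral_ge0.
Qed.

(** A shear: at a fixed head [x] the tail is translated by [x *: c]. *)
Lemma lin_change_lower (R : realType) m (c : 'cV[R]_m) : lin_change (cblock 1 0 c 1%:M).
Proof.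
move=> F mF F0.
rewrite det_cblock_lower. have mc := mmap_mulmx (cblock 1 0 c 1%:M) (@mmap_id R m.+1).
have mFc := mcol_comp mF mc.
rewrite normr1.
rewrite mul1e.
rewrite (colint_cons mFc (fun v => F0 _)).
rewrite (colint_cons mF F0).
apply: eq_integral => x _.
rewrite -[RHS](colint_shift (x *: c)) //; last exact: mcol_ccons.
by apply: eq_colint => v; rewrite cblock_ccons mul1r mul0mx mxE addr0 mul1mx.
Qed.

Lemma lin_change1 (R : realType) m : lin_change (1%:M : 'M[R]_m).
Proof.
move=> F mF F0; rewrite det1 normr1 mul1e.
by apply: eq_colint => v; rewrite mul1mx.
Qed.

Lemma cblockP (R : realType) m (A : 'M[R]_m.+1) : exists a b c (D : 'M[R]_m), A = cblock a b c D.
Proof.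
pose A' : 'M[R]_(1 + m) := A.
exists (ulsubmx A' 0 0), (ursubmx A'), (dlsubmx A'), (drsubmx A').
by rewrite /cblock -mx11_scalar submxK.
Qed.

Lemma cblockM (R : realType) m (a : R) b c (D : 'M[R]_m) a' b' c' (D' : 'M[R]_m) :
  cblock a b c D *m cblock a' b' c' D' =
  cblock (a * a' + (b *m c') 0 0) (a *: b' + b *m D') (a' *: c + D *m c') (c *m b' + D *m D').
Proof.
apply: (etrans (mulmx_block (a%:M : 'M[R]_1) b c D (a'%:M : 'M[R]_1) b' c' D')).
rewrite /cblock; congr (@block_mx _ 1 m 1 m _ _ _ _).
- by rewrite raddfD /= -scalar_mxM -mx11_scalar.
- by rewrite mul_scalar_mx.
- by rewrite mul_mx_scalar.
Qed.

(* LU decomposition along a nonzero pivot. *)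
Lemma lin_change_pivot (R : realType) m (a : R) b c (D : 'M[R]_m) :
  (forall A : 'M[R]_m, A \in unitmx -> lin_change A) ->
  a != 0 -> cblock a b c D \in unitmx -> lin_change (cblock a b c D).
Proof.
move=> IH a0; have -> : cblock a b c D =
    cblock 1 0 (a^-1 *: c) 1%:M *m cblock a b 0 (D - a^-1 *: c *m b).
  rewrite cblockM mul0mx mxE mul1r addr0 scale1r mul0mx addr0 mulmx0 addr0.
  by rewrite scalerA divff// scale1r mul1mx addrC subrK.
rewrite unitmx_mul => /andP[_ U]; apply: lin_change_mul; first exact: lin_change_lower.
apply: lin_change_upper => //; apply: IH; move: U; rewrite !unitmxE det_cblock_upper.
by rewrite unitrM => /andP[].
Qed.

Lemma unitmx_lin_change (R : realType) m (A : 'M[R]_m) : A \in unitmx -> lin_change A.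
Proof.
elim: m A => [|m IH] A uA.
  have -> : A = 1%:M by apply/matrixP => -[].
  exact: lin_change1.
have [a [b [c [D AE]]]] := cblockP A; rewrite AE in uA *.
have [a0|] := eqVneq a 0; last by move=> a0; exact: lin_change_pivot.
(* A zero pivot is made nonzero by adding another row to the first one. *)
have [i ci0] : exists i, c i 0 != 0.
  apply/existsP; apply: contraLR uA; rewrite negb_exists => /forallP c0.
  have -> : c = 0 by apply/colP => i; rewrite mxE; apply/eqP; have := c0 i; rewrite negbK.
  by rewrite unitmxE det_cblock_upper a0 mul0r unitr0.
pose E (e : R) : 'M[R]_m.+1 := cblock 1 (e *: delta_mx 0 i) 0 1%:M.
have EE : E (-1) *m E 1 = 1%:M.
  rewrite /E cblockM !mulmx0 !mulmx1 !scale1r scaleN1r subrr mul0mx mxE mulr1 !addr0 add0r.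
  exact/esym/(scalar_mx_block 1 m (1 : R)).
rewrite -[cblock _ _ _ _]mul1mx -EE -mulmxA; apply: lin_change_mul.
  by apply: lin_change_upper; [exact: oner_neq0|exact: lin_change1].
have uE : E 1 \in unitmx by have /mulmx1_unit[] := EE.
have : E 1 *m cblock a b c D \in unitmx by rewrite unitmx_mul uE.
rewrite /E cblockM; apply: lin_change_pivot => //.
by rewrite a0 mulr0 add0r scale1r -rowE mxE.
Qed.

Lemma colint_affine (R : realType) m (A : 'M[R]_m) (b : 'cV[R]_m) (F : 'cV[R]_m -> \bar R) :
  A \in unitmx -> mcol F -> (forall v, 0 <= F v)%E ->
  (`|\det A|%:E * colint (fun v => F (A *m v + b)%R) = colint F)%E.
Proof.
move=> uA mF F0; rewrite -[RHS](colint_shift b) //.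
apply: (unitmx_lin_change uA (F := fun v => F (v + b))) => //.
by apply: (mcol_comp mF); apply: mmapD; [exact: mmap_id|exact: mmap_cst].
Qed.

(** * The radial shrinkage map *)

(* With [kap = exp (2 alpha k2)] and [a = alpha / s ^ 2], [shrink kap a q] is the
   weight [1 - lambda_hat] of the unrestricted estimator, [q] being
   [|X betaR - X betaU| ^ 2]; [shrinkJ] is the derivative of [r * shrink (r ^ 2)]
   in [r], expressed through [q = r ^ 2]. *)
Definition shrink (R : realType) (kap a q : R) : R := (1 + kap * expR (- (a * q)))^-1.

Definition shrinkJ (R : realType) (kap a q : R) : R :=
  shrink kap a q + 2 * q * (a * kap * expR (- (a * q)) * shrink kap a q ^+ 2).

Section shrink.
Variables (R : realType) (kap a : R).
Hypotheses (kap0 : 0 < kap) (a0 : 0 < a).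
Local Notation H := (shrink kap a).
Local Notation K := (shrinkJ kap a).

Let den_gt1 q : 1 < 1 + kap * expR (- (a * q)).
Proof. by rewrite ltrDl mulr_gt0 ?expR_gt0. Qed.

Let den_gt0 q : 0 < 1 + kap * expR (- (a * q)).
Proof. exact: lt_trans ltr01 (den_gt1 q). Qed.

Lemma shrink_gt0 q : 0 < H q.
Proof. by rewrite invr_gt0. Qed.

Lemma shrink_le1 q : H q <= 1.
Proof. by rewrite invf_le1 // ltW. Qed.

Lemma shrink_homo : {homo H : p q / p <= q}.
Proof.
move=> p q pq; rewrite lef_pV2 ?posrE // lerD2l ler_pM2l // ler_expR lerN2 ler_pM2l //.
Qed.

Lemma shrink_ge q : 0 <= q -> (1 + kap)^-1 <= H q.
Proof.
move=> q0; have := shrink_homo q0.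
by rewrite {1}/shrink mulr0 oppr0 expR0 mulr1.
Qed.

Lemma shrinkJ_gt0 q : 0 <= q -> 0 < K q.
Proof.
move=> q0; rewrite ltr_wpDr ?shrink_gt0 //.
have := shrink_gt0 q; have := expR_gt0 (- (a * q)) => e0 h0.
by rewrite !mulr_ge0 ?exprn_ge0 // ltW.
Qed.

Lemma continuous_shrink : continuous H.
Proof.
move=> q; apply: cvgV; first by rewrite gt_eqF.
apply: cvgD; first exact: cvg_cst.
apply: cvgM; first exact: cvg_cst.
apply: continuous_comp; last exact: continuous_expR.
by apply: cvgN; apply: cvgM; [exact: cvg_cst|exact: cvg_id].
Qed.

Lemma continuous_shrinkJ : continuous K.
Proof.
move=> q; apply: cvgD; first exact: continuous_shrink.
apply: cvgM; first by apply: cvgM; [exact: cvg_cst|exact: cvg_id].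
apply: cvgM; last by apply: cvgM; exact: continuous_shrink.
apply: cvgM; first exact: cvg_cst.
apply: continuous_comp; last exact: continuous_expR.
by apply: cvgN; apply: cvgM; [exact: cvg_cst|exact: cvg_id].
Qed.

(** The radial map on the line through [(1, v)]: for [c = |(1, v)|^2] it sends [t (1, v)] to
    [rshrink c t (1, v)]. *)
Definition rshrink (c r : R) : R := r * H (c * r ^+ 2).

Lemma is_derive_rshrink c r : is_derive r (1 : R) (rshrink c) (K (c * r ^+ 2)).
Proof.
have d1 : is_derive r (1 : R) (fun x : R => - (a * (c * x ^+ 2))) (- (a * (c * (2 * r)))).
  apply: is_derive_eq; rewrite /GRing.scale /=; ring.
have d2 := @is_derive1_comp _ expR (fun x : R => - (a * (c * x ^+ 2))) r _ _ (is_derive_expR (- (a * (c * r ^+ 2)))) d1.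
have d3 : is_derive r (1 : R) (fun x : R => 1 + kap * (expR \o (fun x => - (a * (c * x ^+ 2)))) x)
   (kap * (expR (- (a * (c * r ^+ 2))) * - (a * (c * (2 * r))))).
  by apply: is_derive_eq; rewrite /GRing.scale /= ?addr0 ?add0r //; ring.
have d4 := @is_deriveV _ (fun x : R => 1 + kap * expR (- (a * (c * x ^+ 2)))) r _ _
  (lt0r_neq0 (den_gt0 (c * r ^+ 2))) d3.
have d5 := @is_deriveM _ _ id (fun x : R => (1 + kap * expR (- (a * (c * x ^+ 2))))^-1) r _ _ _
  (is_derive_id r (1 : R)) d4.
apply: (is_derive_eq d5).
rewrite /shrinkJ /shrink /GRing.scale /= !exprVn; ring.
Qed.

(* Strong monotonicity: [rshrink c] has a Lipschitz inverse. *)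
Lemma rshrink_monotone (c x y : R) : 0 <= c ->
  (1 + kap)^-1 * (y - x) ^+ 2 <= (rshrink c y - rshrink c x) * (y - x).
Proof.
move=> c0.
(* With [p] and [q] the weights at [x] and [y], the product splits into the mean of [p] and [q]
   times [(y - x)^2] and a remainder [(q - p)(y^2 - x^2) / 2]. The mean is at least [(1 + kap)^-1],
   and the remainder is nonnegative because the weight increases with the square. *)
have -> : (rshrink c y - rshrink c x) * (y - x) =
  (H (c * y ^+ 2) + H (c * x ^+ 2)) / 2 * (y - x) ^+ 2 +
  (H (c * y ^+ 2) - H (c * x ^+ 2)) * (y ^+ 2 - x ^+ 2) / 2.
  by rewrite /rshrink; field.
rewrite -[X in X <= _]addr0; apply: lerD.
  apply: ler_wpM2r; first exact: sqr_ge0.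
  have h1 := shrink_ge (mulr_ge0 c0 (sqr_ge0 y)).
  have h2 := shrink_ge (mulr_ge0 c0 (sqr_ge0 x)).
  by lra.
apply: mulr_ge0 => //; have [xy|yx] := leP (x ^+ 2) (y ^+ 2).
  apply: mulr_ge0; rewrite subr_ge0 //.
  by apply: shrink_homo; rewrite ler_wpM2l.
apply: mulr_le0; rewrite subr_le0; last exact: ltW.
by apply: shrink_homo; rewrite ler_wpM2l // ltW.
Qed.

Lemma rshrink_mono (c : R) : 0 <= c -> {mono rshrink c : x y / x <= y}.
Proof.
move=> c0; apply: le_mono => x y xy.
have := rshrink_monotone x y c0.
have h : 0 < (1 + kap)^-1 * (y - x) ^+ 2.
  by rewrite mulr_gt0 ?exprn_gt0 ?subr_gt0 // invr_gt0 addr_gt0.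
by move=> /(lt_le_trans h); rewrite pmulr_lgt0 ?subr_gt0.
Qed.

Lemma continuous_rshrink c : continuous (rshrink c).
Proof.
move=> x; apply: differentiable_continuous; apply/derivable1_diffP.
by have [] := is_derive_rshrink c x.
Qed.

Lemma rshrink_surj (c : R) : 0 <= c -> forall y, exists x, rshrink c x = y.
Proof.
move=> c0 y.
have rN x : rshrink c (- x) = - rshrink c x by rewrite /rshrink sqrrN mulNr.
wlog y0 : y / 0 <= y.
  move=> W; have [|y0] := leP 0 y; first exact: W.
  have [|x xE] := W (- y); first by rewrite oppr_ge0 ltW.
  by exists (- x); rewrite rN xE opprK.
(* The weight is at least [(1 + kap)^-1], so the image of [y (1 + kap)] is at least [y], and the
   intermediate value theorem applies between [0] and this point. *)
have b0 : 0 <= y * (1 + kap) by rewrite mulr_ge0 // addr_ge0 // ltW.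
have r0 : rshrink c 0 = 0 by rewrite /rshrink mul0r.
have yb : y <= rshrink c (y * (1 + kap)).
  rewrite /rshrink -[X in X <= _]mulr1 -mulrA ler_wpM2l //.
  rewrite -[X in X <= _](@divff _ (1 + kap)); last by rewrite gt_eqF ?addr_gt0.
  by rewrite ler_pM2l ?addr_gt0 // shrink_ge // mulr_ge0 // sqr_ge0.
have [||x _ <-] := @IVT _ (rshrink c) 0 (y * (1 + kap)) y b0.
- by apply: continuous_subspaceT; exact: continuous_rshrink.
- by rewrite r0 ge_min y0 /= le_max yb orbT.
by exists x.
Qed.

End shrink.

Definition nsq (R : realType) m (v : 'cV[R]_m) : R := \sum_i v i 0 ^+ 2.

Lemma nsq_ge0 (R : realType) m (v : 'cV[R]_m) : 0 <= nsq v.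
Proof. by apply: sumr_ge0 => i _; exact: sqr_ge0. Qed.

Lemma nsqZ (R : realType) m (c : R) (v : 'cV[R]_m) : nsq (c *: v) = c ^+ 2 * nsq v.
Proof. by rewrite /nsq mulr_sumr; apply: eq_bigr => i _; rewrite mxE exprMn. Qed.

Lemma nsq_ccons (R : realType) m (x : R) (v : 'cV[R]_m) :
  nsq (ccons x v) = x ^+ 2 + nsq v.
Proof.
rewrite /nsq big_ord_recl ccons0; congr (_ + _).
by apply: eq_bigr => i _; rewrite cconsS.
Qed.

Lemma nsqE (R : realType) m (v : 'cV[R]_m) : nsq v = (v^T *m v) 0 0.
Proof. by rewrite /nsq mxE; apply: eq_bigr => i _; rewrite mxE. Qed.

Lemma nsq_col_mx (R : realType) p q (v : 'cV[R]_p) (w : 'cV[R]_q) :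
  nsq (col_mx v w) = nsq v + nsq w.
Proof.
rewrite /nsq big_split_ord /=; congr (_ + _).
  by apply: eq_bigr => i _; rewrite col_mxEu.
by apply: eq_bigr => i _; rewrite col_mxEd.
Qed.

Lemma mcol_nsq (R : realType) m p (f : 'cV[R]_p -> 'cV[R]_m) :
  mmap f -> mcol ((fun v => nsq (f v)) : _ -> measurableTypeR R).
Proof. by move=> mf; apply: measurable_sum => i; apply: measurable_funX; exact: mf. Qed.

(** Discards the single value [t = 0], at which projective coordinates degenerate. *)
Lemma eq_integral_off0 (R : realType) (f g : measurableTypeR R -> \bar R) :
  measurable_fun setT f -> measurable_fun setT g -> (forall t, t != 0 -> f t = g t) ->
  (\int[@lebesgue_measure R]_t f t = \int[@lebesgue_measure R]_t g t)%E.
Proof.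
move=> mf mg fg; have mD : measurable ([set: measurableTypeR R] `\ 0).
  exact: measurableD.
rewrite -(@integral_setD1 _ f 0 setT) //; last exact: measurable_funTS.
rewrite -(@integral_setD1 _ g 0 setT) //; last exact: measurable_funTS.
by apply: eq_integral => t; rewrite inE /= => -[_ /eqP]; exact: fg.
Qed.

Section projective.
Variables (R : realType) (m : nat).
Local Notation mu := (@lebesgue_measure R).

(** The transformed integrand as one function of [w = (t, v)], so that it can be integrated in
    either order. *)
Let pj (F : 'cV[R]_m.+1 -> \bar R) (w : 'cV[R]_m.+1) : \bar R :=
  ((`|w ord0 0%R| ^+ m)%:E *
    F (w ord0 0%R *: ccons 1 (\col_i w (lift ord0 i) 0%R))%R)%E.

Let pj_ccons F t (v : 'cV[R]_m) :
  pj F (ccons t v) = ((`|t| ^+ m)%:E * F (t *: ccons 1 v)%R)%E.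
Proof.
rewrite /pj ccons0; congr (_ * F (_ *: ccons _ _)%R)%E.
by apply/colP => i; rewrite mxE cconsS.
Qed.

Let mcol_pj F : mcol F -> mcol (pj F).
Proof.
move=> mF; have m0 : mcol ((fun w => w ord0 0) : 'cV[R]_m.+1 -> measurableTypeR R).
  exact: (@mmap_id R m.+1 ord0).
apply: emeasurable_funM.
  apply/measurable_EFinP/measurable_funX.
  exact: (measurableT_comp _ m0).
apply: (mcol_comp (f := fun w => w ord0 0 *: ccons 1 (\col_i w (lift ord0 i) 0)) mF).
apply: mmapZ => //; apply: mmap_ccons; first exact: measurable_cst.
by move=> i; have := @mmap_id R m.+1 (lift ord0 i); apply: eq_measurable_fun => t _; rewrite mxE.
Qed.

(* Coordinates [t *: (1; v)] on the complement of a null hyperplane: their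
   Jacobian is [|t| ^ m], and a radial map only acts on [t]. *)
Lemma colint_projective (F : 'cV[R]_m.+1 -> \bar R) :
  mcol F -> (forall v, 0 <= F v)%E ->
  colint F = colint (fun v => (\int[mu]_t ((`|t| ^+ m)%:E * F (t *: ccons 1 v)))%E).
Proof.
move=> mF F0; have mP := mcol_pj mF.
have P0 w : (0 <= pj F w)%E by rewrite mule_ge0 // lee_fin exprn_ge0.
transitivity (colint (pj F)); last first.
  rewrite (colint_cons_swap mP P0); apply: eq_colint => v.
  by apply: eq_integral => t _; rewrite pj_ccons.
rewrite (colint_cons mF F0) (colint_cons mP P0).
apply: eq_integral_off0; [exact: measurable_colint|exact: measurable_colint|move=> t t0].
rewrite -(@colint_affine _ _ (t%:M) 0 (fun v => F (ccons t v))).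
- rewrite det_scalar normrX -colintZl //; last first.
  + apply: (mcol_comp (f := fun v => t%:M *m v + 0) (mcol_ccons mF t)); apply: mmapD; last exact: mmap_cst.
    by apply: mmap_mulmx; exact: mmap_id.
  apply: eq_colint => v; rewrite pj_ccons; congr (_ * F _)%E.
  apply/colP => i; rewrite [RHS]mxE addr0 mul_scalar_mx.
  by case: (unliftP ord0 i) => [j|] ->; rewrite ?ccons0 ?mulr1 // !cconsS mxE.
- by rewrite unitmxE det_scalar unitfE expf_neq0.
- exact: mcol_ccons.
- by move=> v.
Qed.

End projective.

Lemma measurable_mcol (R : realType) m d' (X : measurableType d') d (T : measurableType d)
    (F : 'cV[R]_m -> T) (f : X -> 'cV[R]_m) : mcol F ->
  (forall i, measurable_fun setT (fun x => f x i 0 : measurableTypeR R)) ->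
  measurable_fun setT (fun x => F (f x)).
Proof.
move=> mF mf; have mc : measurable_fun setT (fun x => ctup (f x)).
  apply/measurable_fun_tnthP => i; have := mf i; apply: eq_measurable_fun => x _ /=.
  by rewrite tnth_mktuple.
have := measurableT_comp mF mc.
by apply: eq_measurable_fun => x _ /=; rewrite ctupK.
Qed.

Definition rmap (R : realType) (kap a : R) m (v : 'cV[R]_m) : 'cV[R]_m :=
  shrink kap a (nsq v) *: v.

(** The Jacobian determinant of [rmap]: its derivative at [v] acts as [shrink] on the [m - 1]
    directions orthogonal to [v] and as [shrinkJ] along [v]. *)
Definition rjac (R : realType) (kap a : R) m (v : 'cV[R]_m) : R :=
  shrink kap a (nsq v) ^+ m.-1 * shrinkJ kap a (nsq v).

Section radial.
Variables (R : realType) (kap a : R).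
Hypotheses (kap0 : 0 < kap) (a0 : 0 < a).

Lemma rjac_gt0 m (v : 'cV[R]_m) : 0 < rjac kap a v.
Proof. by rewrite mulr_gt0 ?exprn_gt0 ?shrink_gt0 ?shrinkJ_gt0 ?nsq_ge0. Qed.

Lemma mcol_rjac m : mcol (@rjac R kap a m : _ -> measurableTypeR R).
Proof.
have mn := mcol_nsq (@mmap_id R m).
apply: measurable_funM.
  apply: measurable_funX; apply: (measurableT_comp _ mn).
  by apply: continuous_measurable_fun; exact: continuous_shrink.
apply: (measurableT_comp _ mn).
by apply: continuous_measurable_fun; exact: continuous_shrinkJ.
Qed.

Lemma mmap_rmap m : mmap (@rmap R kap a m).
Proof.
apply: mmapZ; last exact: mmap_id.
apply: (measurableT_comp _ (mcol_nsq (@mmap_id R m))).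
by apply: continuous_measurable_fun; exact: continuous_shrink.
Qed.

(** On each line the substitution [t |-> rshrink c t] produces the radial factor [shrinkJ], while
    the projective weight [|rshrink c t|^m = |t|^m shrink^m] supplies the tangential one. *)
Lemma colint_rmap m (F : 'cV[R]_m.+1 -> \bar R) :
  mcol F -> (forall v, 0 <= F v)%E ->
  colint F = colint (fun v => F (rmap kap a v) * (rjac kap a v)%:E)%E.
Proof.
move=> mF F0.
rewrite (colint_projective mF F0) colint_projective; last 2 first.
- apply: emeasurable_funM; first exact: (mcol_comp mF (@mmap_rmap m.+1)).
  by apply/measurable_EFinP; exact: mcol_rjac.
- by move=> v; rewrite mule_ge0 // lee_fin ltW // rjac_gt0.
apply: eq_colint => v; pose c := 1 + nsq v.
have c0 : 0 <= c by rewrite addr_ge0 // nsq_ge0.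
have mono := rshrink_mono kap0 a0 c0.
have surj := rshrink_surj kap0 a0 c0.
have drv x := is_derive_rshrink a kap0 c x.
have cK : continuous (fun r : R => shrinkJ kap a (c * r ^+ 2)).
  move=> x; apply: (@continuous_comp _ _ _ (fun r : R => c * r ^+ 2) (shrinkJ kap a)); last exact: continuous_shrinkJ.
  by apply: cvgM; [exact: cvg_cst|exact: exprn_continuous].
have K0 x : 0 <= shrinkJ kap a (c * x ^+ 2).
  by rewrite ltW // shrinkJ_gt0 // mulr_ge0 // sqr_ge0.
rewrite (substitution mono surj drv cK K0); last 2 first.
- apply: emeasurable_funM.
    by apply/measurable_EFinP/measurable_funX; apply: (measurableT_comp (f := @Num.norm R R)).
  apply: (measurable_mcol (f := fun t : measurableTypeR R => t *: ccons 1 v) mF) => i.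
  apply: (eq_measurable_fun (fun t : measurableTypeR R => t * ccons 1 v i 0)).
    by move=> t _; rewrite [RHS]mxE.
  by apply: measurable_funM => //; exact: measurable_cst.
- by move=> t; rewrite mule_ge0 // lee_fin exprn_ge0.
apply: eq_integral => t _.
have nE : nsq (t *: ccons 1 v) = c * t ^+ 2.
  by rewrite nsqZ nsq_ccons expr1n mulrC.
rewrite /rjac /rmap nE scalerA /= /rshrink [t * _]mulrC.
rewrite muleAC -EFinM [RHS]muleCA -EFinM muleC; congr (_ * _%:E)%E.
by rewrite normrM exprMn [`|shrink _ _ _|]gtr0_norm ?shrink_gt0 // [LHS]mulrAC [LHS]mulrC.
Qed.

End radial.

(** The inverse of [rshrink kap a 1]. For positive [kap] and [a] that map is onto, so the default
    [0] of [xget] is never taken. *)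
Definition rexpand (R : realType) (kap a y : R) : R :=
  xget 0 [set x | rshrink kap a 1 x = y].

(** The inverse of [rmap]: the preimage of [v] lies on the ray of [v] at distance
    [rexpand kap a (enorm v)], and [v] is divided by the weight at that distance. *)
Definition emap (R : realType) (kap a : R) m (v : 'cV[R]_m) : 'cV[R]_m :=
  (shrink kap a (rexpand kap a (enorm v) ^+ 2))^-1 *: v.

Section expand.
Variables (R : realType) (kap a : R).
Hypotheses (kap0 : 0 < kap) (a0 : 0 < a).
Local Notation H := (shrink kap a).

Lemma rexpandK y : rshrink kap a 1 (rexpand kap a y) = y.
Proof. by rewrite /rexpand; case: xgetP => // /(_ _)/= N; have [x /N] := rshrink_surj kap0 a0 ler01 y. Qed.

Lemma rshrinkK x : rexpand kap a (rshrink kap a 1 x) = x.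
Proof. by apply: (inc_inj (rshrink_mono kap0 a0 ler01)); exact: rexpandK. Qed.

(** Strong monotonicity of [rshrink], read at the preimages and divided by their distance. *)
Lemma rexpand_lipschitz x y :
  `|rexpand kap a x - rexpand kap a y| <= (1 + kap) * `|x - y|.
Proof.
have := rshrink_monotone kap0 a0 (rexpand kap a y) (rexpand kap a x) ler01.
rewrite !rexpandK; set u := rexpand kap a x - _; set w := x - y => uw.
have k1 : 0 < 1 + kap by rewrite addr_gt0.
have [->|u0] := eqVneq u 0; first by rewrite normr0 mulr_ge0 // ltW.
rewrite -(ler_pM2l (_ : 0 < `|u|)) ?normr_gt0 // -(ler_pM2l (_ : 0 < (1 + kap)^-1)) ?invr_gt0 //.
have -> : (1 + kap)^-1 * (`|u| * ((1 + kap) * `|w|)) = `|u| * `|w|.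
  by rewrite mulrCA mulKf // gt_eqF.
rewrite -expr2 real_normK ?num_real //.
by apply: (le_trans uw); rewrite mulrC -normrM ler_norm.
Qed.

Lemma continuous_rexpand : continuous (rexpand kap a).
Proof.
move=> x; apply/cvgrPdist_le => e e0; near=> y.
apply: (le_trans (rexpand_lipschitz x y)); rewrite -ler_pdivlMl ?addr_gt0 //.
near: y; have /cvgrPdist_le : y @[y --> x] --> x by exact: cvg_id.
by apply; rewrite mulr_gt0 // invr_gt0 addr_gt0.
Unshelve. all: by end_near.
Qed.

(** The weight is at most 1, so the inverse can only increase norms. Hence preimages of points that
    escape to infinity escape as well. *)
Lemma rexpand_ge y : 0 <= y -> y <= rexpand kap a y.
Proof.
move=> y0; have r0 : 0 <= rexpand kap a y.
  rewrite -(rshrink_mono kap0 a0 ler01) rexpandK.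
  by rewrite /rshrink mul0r.
by rewrite -[X in X <= _]rexpandK /rshrink ler_piMr // shrink_le1.
Qed.

Lemma nsq_emap m (v : 'cV[R]_m) : nsq (emap kap a v) = rexpand kap a (enorm v) ^+ 2.
Proof.
rewrite nsqZ exprVn -[nsq v](_ : enorm v ^+ 2 = _); last by rewrite sqr_sqrtr // nsq_ge0.
rewrite -{2}(rexpandK (enorm v)) /rshrink mul1r exprMn mulrCA mulVf ?mulr1 //.
by rewrite expf_neq0 // gt_eqF // shrink_gt0.
Qed.

Lemma rmapK m (v : 'cV[R]_m) : emap kap a (rmap kap a v) = v.
Proof.
have h0 := shrink_gt0 a kap0 (nsq v).
rewrite /emap (_ : enorm (rmap kap a v) = rshrink kap a 1 (enorm v)); last first.
  rewrite {1}/enorm -/(nsq _) nsqZ sqrtrM ?sqr_ge0 // sqrtr_sqr gtr0_norm //.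
  by rewrite /rshrink mul1r sqr_sqrtr ?nsq_ge0 // mulrC.
rewrite rshrinkK sqr_sqrtr ?nsq_ge0 // /rmap scalerA -/(nsq v) mulVf ?scale1r //.
by rewrite gt_eqF.
Qed.

Lemma continuous_escale : continuous (fun q : R => (H (rexpand kap a (Num.sqrt q) ^+ 2))^-1).
Proof.
move=> q; apply: cvgV; first by rewrite gt_eqF // shrink_gt0.
apply: (@continuous_comp _ _ _ (fun q => rexpand kap a (Num.sqrt q) ^+ 2) H); last exact: continuous_shrink.
apply: (@continuous_comp _ _ _ (fun q => rexpand kap a (Num.sqrt q)) (fun x => x ^+ 2)); last exact: exprn_continuous.
apply: (@continuous_comp _ _ _ Num.sqrt (rexpand kap a)); last exact: continuous_rexpand.
exact: sqrt_continuous.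
Qed.

Lemma mmap_emap m : mmap (@emap R kap a m).
Proof.
apply: mmapZ; last exact: mmap_id.
have mq := continuous_measurable_fun continuous_escale.
exact: (measurableT_comp mq (mcol_nsq (@mmap_id R m))).
Qed.

Lemma colint_rmap_pos m (F : 'cV[R]_m -> \bar R) : (0 < m)%N ->
  mcol F -> (forall v, 0 <= F v)%E ->
  colint F = colint (fun v => F (rmap kap a v) * (rjac kap a v)%:E)%E.
Proof. by case: m F => // m F _; exact: colint_rmap. Qed.

End expand.

(** * Gaussian laws and their images *)

Definition gpdf (R : realType) (s : R) m (v : 'cV[R]_m) : R := \prod_i normal_pdf 0 s (v i 0).

Lemma gpdf_ge0 (R : realType) (s : R) m (v : 'cV[R]_m) : 0 <= gpdf s v.
Proof. by apply: prodr_ge0 => i _; exact: normal_pdf_ge0. Qed.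

Lemma mcol_gpdf (R : realType) (s : R) m p (f : 'cV[R]_p -> 'cV[R]_m) :
  mmap f -> mcol ((fun v => gpdf s (f v)) : _ -> measurableTypeR R).
Proof.
move=> mf; apply: measurable_prod => i _.
by apply: (measurableT_comp (@measurable_normal_pdf R 0 s)); exact: mf.
Qed.

Lemma gpdf_col_mx (R : realType) (s : R) p q (v : 'cV[R]_p) (w : 'cV[R]_q) :
  gpdf s (col_mx v w) = gpdf s v * gpdf s w.
Proof.
rewrite /gpdf big_split_ord /=; congr (_ * _).
  by apply: eq_bigr => i _; rewrite col_mxEu.
by apply: eq_bigr => i _; rewrite col_mxEd.
Qed.

Lemma colint_gpdf (R : realType) (s : R) m : s != 0 ->
  colint (fun v : 'cV[R]_m => (gpdf s v)%:E) = 1%E.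
Proof.
move=> s0; elim: m => [|m IH].
  rewrite colint_leb_int /=; first by rewrite /gpdf big_ord0.
    by apply/measurable_EFinP; exact: (mcol_gpdf s (@mmap_id R 0)).
  by move=> v; rewrite lee_fin gpdf_ge0.
rewrite colint_cons; last 2 first.
- by apply/measurable_EFinP; exact: (mcol_gpdf s (@mmap_id R m.+1)).
- by move=> v; rewrite lee_fin gpdf_ge0.
rewrite -(integral_normal_pdf 0 s); apply: eq_integral => x _.
rewrite -[RHS]mule1 -IH -colintZl ?normal_pdf_ge0 //; last 2 first.
- by apply/measurable_EFinP; exact: (mcol_gpdf s (@mmap_id R m)).
- by move=> v; rewrite lee_fin gpdf_ge0.
apply: eq_colint => v; rewrite -EFinM; congr EFin.
rewrite /gpdf big_ord_recl ccons0; congr (_ * _).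
by apply: eq_bigr => i _; rewrite cconsS.
Qed.

Lemma gpdfE (R : realType) (s : R) m (v : 'cV[R]_m) : s != 0 ->
  gpdf s v = normal_peak s ^+ m * expR (- nsq v / (s ^+ 2 *+ 2)).
Proof.
move=> s0; rewrite /gpdf normal_pdfE // big_split /= prodr_const card_ord; congr (_ * _).
rewrite -expR_sum; congr expR.
by rewrite -mulr_suml sumrN; congr (- _ / _); apply: eq_bigr => i _; rewrite subr0.
Qed.

(** The density of [rmap (z2 + c) - c] for Gaussian [z2]: the Gaussian density at the preimage of
    [y], divided by the Jacobian of [rmap] there. *)
Definition fdens2 (R : realType) (kap a s : R) m (c y : 'cV[R]_m) : R :=
  gpdf s (emap kap a (y + c) - c) / rjac kap a (emap kap a (y + c)).

(* The density of [invmx U (z1, rmap (z2 + c) - c)] for [(z1, z2)] Gaussian. *)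
Definition fdens (R : realType) (kap a s : R) (k1 k2 : nat) (U : 'M[R]_(k1 + k2))
    (c : 'cV[R]_k2) (t : 'cV[R]_(k1 + k2)) : R :=
  `|\det U| * (gpdf s (usubmx (U *m t)) * fdens2 kap a s c (dsubmx (U *m t))).

(** The form shared by the estimator ([beta_tildeE]) and by the limit variable ([W_gammaE]). *)
Definition rlaw (R : realType) (kap a : R) (k1 k2 : nat) (L : 'M[R]_(k1 + k2))
    (c : 'cV[R]_k2) (z : 'cV[R]_(k1 + k2)) : 'cV[R]_(k1 + k2) :=
  L *m col_mx (usubmx z) (rmap kap a (dsubmx z + c) - c).

Section law.
Variables (R : realType) (kap a s : R) (k1 k2 : nat).
Hypotheses (kap0 : 0 < kap) (a0 : 0 < a) (k20 : (0 < k2)%N).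

Lemma fdens2_ge0 (c y : 'cV[R]_k2) : 0 <= fdens2 kap a s c y.
Proof. by rewrite divr_ge0 ?gpdf_ge0 // ltW // rjac_gt0. Qed.

Lemma fdens_ge0 U c (t : 'cV[R]_(k1 + k2)) : 0 <= fdens kap a s U c t.
Proof. by rewrite mulr_ge0 // mulr_ge0 ?gpdf_ge0 ?fdens2_ge0. Qed.

Let mD m (c : 'cV[R]_m) : mmap (fun v => v + c).
Proof. by apply: mmapD; [exact: mmap_id|exact: mmap_cst]. Qed.

Lemma mcol_fdens2 (c : 'cV[R]_k2) : mcol (fdens2 kap a s c : _ -> measurableTypeR R).
Proof.
have me : mmap (fun y => emap kap a (y + c)).
  exact: (mmap_comp (mmap_emap kap0 a0 (m := k2)) (mD c)).
apply: measurable_funM.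
  exact: (mcol_gpdf s (mmapD me (@mmap_cst R k2 k2 (- c)))).
have mj := mcol_comp (mcol_rjac a kap0 (m := k2)) me.
(* The reciprocal is treated as the power [-1], with which it agrees on the positive values of
   [rjac]. *)
have := measurableT_comp (@measurable_powR R (-1)) mj.
by apply: eq_measurable_fun => t _ /=; rewrite powR_inv1 // ltW // rjac_gt0.
Qed.

Lemma mcol_fdens U c : mcol (@fdens R kap a s k1 k2 U c : _ -> measurableTypeR R).
Proof.
have mU := mmap_mulmx U (@mmap_id R (k1 + k2)).
apply: measurable_funM; first exact: measurable_cst.
apply: measurable_funM; first exact: (mcol_gpdf s (mmap_usubmx mU)).
exact: (mcol_comp (mcol_fdens2 c) (mmap_dsubmx mU)).
Qed.

Lemma mmap_rlaw L c : mmap (@rlaw R kap a k1 k2 L c).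
Proof.
have mdd := mmap_dsubmx (@mmap_id R (k1 + k2)).
apply: mmap_mulmx; apply: mmap_col_mx; first exact: mmap_usubmx (@mmap_id _ _).
apply: mmapD; last exact: mmap_cst.
apply: (mmap_comp (mmap_rmap a kap0 (m := k2))).
by apply: mmapD => //; exact: mmap_cst.
Qed.

(** Translation by [c] centres the radial map. The change of variables [colint_rmap_pos] is then
    applied to an integrand that already contains [1 / rjac] at the preimage, so the new Jacobian
    cancels it; translating back gives [fdens2]. *)
Lemma colint_rlaw2 (c : 'cV[R]_k2) (F : 'cV[R]_k2 -> \bar R) :
  mcol F -> (forall v, 0 <= F v)%E ->
  colint (fun v => F (rmap kap a (v + c) - c)%R * (gpdf s v)%:E)%E =
  colint (fun y => F y * (fdens2 kap a s c y)%:E)%E.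
Proof.
move=> mF F0.
have mg : mcol (fun v => F (rmap kap a v - c)).
  by apply: (mcol_comp mF); apply: mmapD; [exact: mmap_rmap|exact: mmap_cst].
transitivity (colint (fun v => F (rmap kap a v - c)%R * (gpdf s (v - c))%:E)%E).
  rewrite -[RHS](colint_shift c).
  - by apply: eq_colint => v; rewrite addrK.
  - apply: emeasurable_funM => //; apply/measurable_EFinP.
    exact: (mcol_gpdf s (mD (- c))).
  - by move=> v; rewrite mule_ge0 // lee_fin gpdf_ge0.
have mk : mcol (fun y => F (y - c)%R * (gpdf s (emap kap a y - c) / rjac kap a (emap kap a y))%:E)%E.
  have me := mmap_emap kap0 a0 (m := k2).
  apply: emeasurable_funM; first exact: (mcol_comp mF (mD (- c))).
  have := mcol_comp (mcol_fdens2 c) (mD (- c)).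
  move/measurable_EFinP; apply: eq_measurable_fun => t _ /=.
  by rewrite /fdens2 subrK.
have k0 y : (0 <= F (y - c)%R * (gpdf s (emap kap a y - c) / rjac kap a (emap kap a y))%:E)%E.
  by rewrite mule_ge0 // lee_fin divr_ge0 ?gpdf_ge0 // ltW // rjac_gt0.
transitivity (colint (fun y => F (y - c)%R * (gpdf s (emap kap a y - c) / rjac kap a (emap kap a y))%:E)%E).
  rewrite [RHS](colint_rmap_pos kap0 a0 k20 mk k0); apply: eq_colint => v.
  rewrite rmapK // -muleA -EFinM divfK // gt_eqF // rjac_gt0 //.
rewrite -(colint_shift c mk k0); apply: eq_colint => y.
by rewrite addrK.
Qed.

(** The linear change of variables by [U] accounts for [|det U|]. Fubini then freezes the first
    block, whose Gaussian factor is a constant for [colint_rlaw2]. *)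
Lemma colint_rlaw U c (F : 'cV[R]_(k1 + k2) -> \bar R) : U \in unitmx ->
  mcol F -> (forall v, 0 <= F v)%E ->
  colint (fun z => F (rlaw kap a (invmx U) c z) * (gpdf s z)%:E)%E =
  colint (fun t => F t * (fdens kap a s U c t)%:E)%E.
Proof.
move=> uU mF F0.
have mFU : mcol (fun w => F (invmx U *m w)).
  by apply: (mcol_comp mF); apply: mmap_mulmx; exact: mmap_id.
pose k w := (F (invmx U *m w) * (gpdf s (usubmx w) * fdens2 kap a s c (dsubmx w))%:E)%E.
have mk : mcol k.
  apply: emeasurable_funM => //; apply/measurable_EFinP; apply: measurable_funM.
    exact: (mcol_gpdf s (mmap_usubmx (@mmap_id R (k1 + k2)))).
  exact: (mcol_comp (mcol_fdens2 c) (mmap_dsubmx (@mmap_id R (k1 + k2)))).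
have k0 w : (0 <= k w)%E.
  by rewrite mule_ge0 // lee_fin mulr_ge0 ?gpdf_ge0 ?fdens2_ge0.
transitivity (colint k); last first.
  have mkU : mcol (fun t => k (U *m t + 0)).
    apply: (mcol_comp (f := fun t => U *m t + 0) mk); apply: mmapD; last exact: mmap_cst.
    by apply: mmap_mulmx; exact: mmap_id.
  rewrite -(colint_affine 0 uU mk k0) -(colintZl mkU (fun t => k0 _) (normr_ge0 _)).
  by congr colint; apply/funext => t; rewrite /k addr0 mulKmx // muleCA -EFinM.
have mz : mcol (fun z => F (rlaw kap a (invmx U) c z) * (gpdf s z)%:E)%E.
  apply: emeasurable_funM; first exact: (mcol_comp mF (@mmap_rlaw _ c)).
  by apply/measurable_EFinP; exact: (mcol_gpdf s (@mmap_id R (k1 + k2))).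
have z0 z : (0 <= F (rlaw kap a (invmx U) c z) * (gpdf s z)%:E)%E.
  by rewrite mule_ge0 // lee_fin gpdf_ge0.
apply: (etrans (colint_cat mz z0)); apply: (etrans _ (esym (colint_cat mk k0))).
congr colint; apply/funext => x1.
have mF1 : mcol (fun v => F (invmx U *m col_mx x1 v)).
  apply: (mcol_comp mF); apply: mmap_mulmx; apply: mmap_col_mx; [exact: mmap_cst|exact: mmap_id].
transitivity (colint (fun v =>
    ((gpdf s x1)%:E * F (invmx U *m col_mx x1 (rmap kap a (v + c) - c))%R) * (gpdf s v)%:E)%E).
  congr colint; apply/funext => b; rewrite /rlaw col_mxKu col_mxKd gpdf_col_mx.
  by rewrite EFinM muleA [in RHS](muleC (gpdf s x1)%:E).
rewrite (@colint_rlaw2 c (fun v => (gpdf s x1)%:E * F (invmx U *m col_mx x1 v))%E).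
- congr colint; apply/funext => b; rewrite /k col_mxKu col_mxKd.
  by rewrite (EFinM (gpdf s x1)) muleA; congr (_ * _)%E; rewrite muleC.
- by apply: emeasurable_funM => //; exact: measurable_cst.
- by move=> v; rewrite mule_ge0 // lee_fin gpdf_ge0.
Qed.

End law.

(** * Matrix factorizations *)

Lemma addmxE (V : nmodType) m n (A B : 'M[V]_(m, n)) i j : (A + B) i j = A i j + B i j.
Proof. by rewrite mxE. Qed.

Lemma oppmxE (V : zmodType) m n (A : 'M[V]_(m, n)) i j : (- A) i j = - A i j.
Proof. by rewrite mxE. Qed.

Lemma scalemxE (V : pzRingType) m n x (A : 'M[V]_(m, n)) i j : (x *: A) i j = x * A i j.
Proof. by rewrite mxE. Qed.

Lemma trmxE (T : Type) m n (A : 'M[T]_(m, n)) i j : A^T i j = A j i.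
Proof. by rewrite mxE. Qed.

Lemma mul_tr_ccons (R : realType) m x (v : 'cV[R]_m) y (w : 'cV[R]_m) :
  ((ccons x v)^T *m ccons y w) 0 0 = x * y + (v^T *m w) 0 0.
Proof.
rewrite mxE big_ord_recl !trmxE !ccons0; congr (_ + _).
by rewrite [RHS]mxE; apply: eq_bigr => i _; rewrite !trmxE !cconsS.
Qed.

Lemma quad_cblock (R : realType) m (a : R) b c (D : 'M[R]_m) x v :
  ((ccons x v)^T *m cblock a b c D *m ccons x v) 0 0 =
  a * x ^+ 2 + x * (b *m v) 0 0 + x * (v^T *m c) 0 0 + (v^T *m D *m v) 0 0.
Proof.
rewrite -mulmxA cblock_ccons mul_tr_ccons mulmxDr addmxE -scalemxAr mulmxA.
by rewrite scalemxE; ring.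
Qed.

Lemma tr_cblock (R : realType) m (a : R) b c (D : 'M[R]_m) :
  (cblock a b c D)^T = cblock a c^T b^T D^T.
Proof. by rewrite /cblock (tr_block_mx (a%:M : 'M[R]_1)) tr_scalar_mx. Qed.

Lemma cblock_inj (R : realType) m (a a' : R) b b' c c' (D D' : 'M[R]_m) :
  cblock a b c D = cblock a' b' c' D' -> [/\ a = a', b = b', c = c' & D = D'].
Proof.
move=> /(@eq_block_mx _ 1 m 1 m) [e -> -> ->]; split=> //.
by move/matrixP : e => /(_ 0 0); rewrite !mxE eqxx !mulr1n.
Qed.

Lemma posdef_cblock (R : realType) m (a : R) b c (D : 'M[R]_m) :
  posdef (cblock a b c D) ->
  [/\ b = c^T, 0 < a, D^T = D & posdef (D - a^-1 *: (c *m c^T))].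
Proof.
case=> + pos; rewrite tr_cblock => /cblock_inj[_ bE _ DE].
have a0 : 0 < a.
  have := pos (ccons 1 0); rewrite quad_cblock !mulmx0 trmx0 mul0mx mxE mulr0 !addr0 expr1n mulr1.
  apply; apply/eqP => /colP /(_ ord0); rewrite ccons0 mxE => /eqP.
  by rewrite oner_eq0.
split => //; split; first by rewrite linearB linearZ /= trmx_mul trmxK DE.
(* This [x] minimizes the quadratic form at given [v]; completing the square leaves the Schur
   complement evaluated at [v]. *)
move=> v v0; pose x := - a^-1 * (c^T *m v) 0 0.
have := pos (ccons x v); rewrite quad_cblock.
have bv : (v^T *m c) 0 0 = (c^T *m v) 0 0.
  by rewrite -[in RHS](trmxK v) -trmx_mul trmxE.
have -> : (v^T *m (D - a^-1 *: (c *m c^T)) *m v) 0 0 =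
   (v^T *m D *m v) 0 0 - a^-1 * (c^T *m v) 0 0 ^+ 2.
  rewrite mulmxBr mulmxBl addmxE oppmxE -scalemxAr -scalemxAl scalemxE.
  by rewrite mulmxA -(mulmxA (v^T *m c)) [X in _ - _ * X = _]mxE big_ord1 bv.
rewrite -bE bv => h.
have -> : (v^T *m D *m v) 0 0 - a^-1 * (c^T *m v) 0 0 ^+ 2 =
  a * x ^+ 2 + x * (c^T *m v) 0 0 + x * (c^T *m v) 0 0 + (v^T *m D *m v) 0 0.
  by rewrite /x; field; rewrite gt_eqF.
apply: h; apply: contraNneq v0 => e; apply/eqP/colP => i.
by move/colP : e => /(_ (lift ord0 i)); rewrite cconsS !mxE.
Qed.

(** The Cholesky factor by explicit recursion on Schur complements, so that its continuity follows
    by the same recursion. *)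
Fixpoint chol (R : realType) (m : nat) : 'M[R]_m -> 'M[R]_m :=
  match m return 'M[R]_m -> 'M[R]_m with
  | 0 => id
  | m'.+1 => fun A : 'M[R]_(1 + m') =>
    let a := A ord0 ord0 in let c := dlsubmx A in
    cblock (Num.sqrt a) 0 ((Num.sqrt a)^-1 *: c)
      (chol (drsubmx A - a^-1 *: (c *m c^T)))
  end.

Lemma chol_cblock (R : realType) m (a : R) b c (D : 'M[R]_m) :
  chol (cblock a b c D) = cblock (Num.sqrt a) 0 ((Num.sqrt a)^-1 *: c)
      (chol (D - a^-1 *: (c *m c^T))).
Proof.
rewrite /= /cblock block_mxKdl block_mxKdr.
suff -> : (block_mx (a%:M : 'M[R]_1) b c D) ord0 ord0 = a by [].
have -> : ord0 = lshift m (ord0 : 'I_1) :> 'I_(1 + m) by exact/val_inj.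
by rewrite block_mxEul mxE eqxx mulr1n.
Qed.

Lemma cholP (R : realType) m (A : 'M[R]_m) : posdef A -> chol A *m (chol A)^T = A.
Proof.
elim: m A => [|m IH] A; first by move=> _; apply/matrixP => -[].
have [a [b [c [D ->]]]] := cblockP A => /posdef_cblock[-> a0 DE pS].
have s0 : Num.sqrt a != 0 by rewrite gt_eqF // sqrtr_gt0.
have ss : Num.sqrt a * Num.sqrt a = a by rewrite -expr2 sqr_sqrtr // ltW.
rewrite chol_cblock tr_cblock cblockM IH // trmx0 !mul0mx !mulmx0 [(0 : 'M[R]_1) 0 0]mxE !addr0.
rewrite ss linearZ /= !scalerA divff // !scale1r -scalemxAl -scalemxAr scalerA.
by rewrite -invfM ss addrC subrK.
Qed.

Lemma chol_lower (R : realType) m (A : 'M[R]_m) (i j : 'I_m) : (i < j)%N -> chol A i j = 0.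
Proof.
elim: m A i j => [|m IH] A i j; first by case: i.
have [a [b [c [D ->]]]] := cblockP A; rewrite chol_cblock /cblock.
case: (@split_ordP 1 m i) => i' ->; case: (@split_ordP 1 m j) => j' ->.
- by rewrite !ord1.
- by move=> _; apply: (etrans (block_mxEur _ _ _ _ i' j')); rewrite mxE.
- by rewrite /= ord1.
- by move=> ij; apply: (etrans (block_mxEdr _ _ _ _ i' j')); exact: IH.
Qed.

Lemma posdef_unit (R : realType) m (A : 'M[R]_m) : posdef A -> A \in unitmx.
Proof.
move=> [_ pos]; rewrite -row_free_unit -kermx_eq0.
apply/negPn/negP => /rowV0Pn[v /sub_kermxP vA v0].
have := pos v^T; rewrite trmxK vA mul0mx mxE ltxx.
by move=> /(_ _)/negP; apply; rewrite // -trmx0 (inj_eq trmx_inj).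
Qed.

Lemma posdef_gram (R : realType) m n (A : 'M[R]_(m, n)) : row_free A -> posdef (A *m A^T).
Proof.
move=> fA; split; first by rewrite trmx_mul trmxK.
move=> v v0; have -> : v^T *m (A *m A^T) *m v = (A^T *m v)^T *m (A^T *m v).
  by rewrite trmx_mul trmxK !mulmxA.
rewrite -nsqE lt_neqAle nsq_ge0 andbT eq_sym psumr_neq0; last by move=> i _; exact: sqr_ge0.
apply/hasP; apply: contrapT => N.
have : v^T *m A = 0.
  have -> : v^T *m A = (A^T *m v)^T by rewrite trmx_mul trmxK.
  apply/rowP => j; rewrite trmxE [RHS]mxE; apply/eqP/negPn/negP => jN; apply: N.
  by exists j; rewrite ?mem_index_enum //= lt0r sqr_ge0 andbT sqrf_eq0.
move=> /eqP; rewrite mulmx_free_eq0 // => /eqP vT.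
by move: v0; rewrite -[v]trmxK vT trmx0 eqxx.
Qed.

(** The new rows are a basis [K] of the kernel of [N^T], orthonormalized by the inverse Cholesky
    factor of its Gram matrix [K K^T]. *)
Lemma orthonormal_completion (R : realType) k n (N : 'M[R]_(k, n)) : N *m N^T = 1%:M ->
  exists j (G : 'M[R]_(j, n)), [/\ n = (k + j)%N, G *m G^T = 1%:M & N *m G^T = 0].
Proof.
move=> NN; pose K := row_base (kermx N^T).
have fN : \rank N = k.
  apply/eqP; rewrite eqn_leq rank_leq_row /=.
  by have := mxrankM_maxl N N^T; rewrite NN mxrank1.
have KN : K *m N^T = 0.
  by apply/sub_kermxP; rewrite eq_row_base.
have pK : posdef (K *m K^T) by exact/posdef_gram/row_base_free.
pose L := chol (K *m K^T); have LL : L *m L^T = K *m K^T by exact: cholP.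
have uL : L \in unitmx by have := posdef_unit pK; rewrite -LL unitmx_mul => /andP[].
exists (\rank (kermx N^T)), (invmx L *m K); split.
- by rewrite mxrank_ker mxrank_tr fN subnKC // -{1}fN rank_leq_col.
- by rewrite trmx_mul mulmxA -(mulmxA (invmx L)) -LL mulKmx // -trmx_mul mulVmx // trmx1.
- apply: trmx_inj; rewrite trmx_mul trmxK -mulmxA KN mulmx0 trmx0 //.
Qed.

Lemma nsq_eq0 (R : realType) m (v : 'cV[R]_m) : nsq v = 0 -> v = 0.
Proof.
move=> /eqP; rewrite psumr_eq0; last by move=> i _; exact: sqr_ge0.
move=> /allP v0; apply/colP => i; rewrite mxE; apply/eqP.
by have := v0 i; rewrite mem_index_enum sqrf_eq0 => /(_ isT).
Qed.

(* A complex eigenvalue [x + i y] makes [(A - x)^2 + y^2] singular; on a real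
   kernel vector [u] the symmetry of [A] gives [|(A - x) u|^2 + y^2 |u|^2 = 0]. *)
Lemma symmetric_eigen (R : realType) m (A : 'M[R]_m.+1) : A^T = A ->
  exists x (v : 'cV[R]_m.+1), v != 0 /\ A *m v = x *: v.
Proof.
move=> As; pose f : {rmorphism R -> complex R} := real_complex R.
have /closed_rootP[[x y]] : size (char_poly (map_mx f A)) != 1%N by rewrite size_char_poly.
rewrite -eigenvalue_root_char => /eigenvalueP[v vA v0].
pose B := (A - x%:M) *m (A - x%:M) + (y ^+ 2)%:M.
have vAx : v *m map_mx f (A - x%:M) = Complex 0 y *: v.
  rewrite map_mxB map_scalar_mx mulmxBr vA mul_mx_scalar -scalerBl; congr (_ *: _).
  by apply/eqP; rewrite eq_complex /= subrr subr0 !eqxx.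
have : B \notin unitmx.
  rewrite -(map_unitmx f) -row_free_unit -kermx_eq0; apply/rowV0Pn; exists v => //.
  apply/sub_kermxP; rewrite map_mxD map_mxM mulmxDr mulmxA vAx -scalemxAl vAx.
  rewrite map_scalar_mx mul_mx_scalar scalerA -scalerDl.
  rewrite (_ : _ + _ = 0) ?scale0r //.
  by apply/eqP; rewrite eq_complex /= !mul0r !mulr0 !sub0r !addr0 expr2 addNr eqxx.
rewrite -row_free_unit -kermx_eq0 => /rowV0Pn[w /sub_kermxP wB w0].
pose u := w^T; have u0 : u != 0 by rewrite -trmx0 (inj_eq trmx_inj).
have Axs : (A - x%:M)^T = A - x%:M by rewrite linearB /= As tr_scalar_mx.
have : nsq ((A - x%:M) *m u) + y ^+ 2 * nsq u = 0.
  have : (w *m B *m u) 0 0 = 0 by rewrite wB mul0mx mxE.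
  rewrite /B mulmxDr mulmxDl addmxE mul_mx_scalar -scalemxAl scalemxE !nsqE.
  by rewrite trmx_mul Axs /u trmxK !mulmxA.
move=> e; have n0 : nsq ((A - x%:M) *m u) = 0.
  apply/eqP; rewrite eq_le nsq_ge0 andbT -e lerDl.
  by rewrite mulr_ge0 ?sqr_ge0 ?nsq_ge0.
exists x, u; split=> //; apply/eqP; rewrite -subr_eq0 -mul_scalar_mx -mulmxBl.
by rewrite (nsq_eq0 n0).
Qed.

Lemma posdef_conj (R : realType) m (A O : 'M[R]_m) : posdef A -> O \in unitmx ->
  posdef (O^T *m A *m O).
Proof.
move=> [As pos] uO; split; first by rewrite !trmx_mul trmxK As mulmxA.
move=> v v0; have := pos (O *m v); rewrite trmx_mul !mulmxA; apply.
by apply: contraNneq v0 => e; rewrite -(mulKmx uO v) e mulmx0.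
Qed.

Lemma posdef_cblock0 (R : realType) m (a : R) (D : 'M[R]_m) : 0 < a -> posdef D ->
  posdef (cblock a 0 0 D).
Proof.
move=> a0 [Ds pos]; split; first by rewrite tr_cblock !trmx0 Ds.
move=> v; have [x [w ->]] := cconsP v; rewrite quad_cblock mul0mx mulmx0 [(0 : 'M[R]_1) 0 0]mxE.
rewrite !mulr0 !addr0; have [->|w0 _] := eqVneq w 0; last first.
  by rewrite ltr_wpDl ?pos // mulr_ge0 ?sqr_ge0 // ltW.
rewrite mulmx0 mxE addr0 => xw; rewrite mulr_gt0 // lt0r sqr_ge0 andbT sqrf_eq0.
apply: contraNneq xw => ->; apply/eqP/colP => i.
by case: (unliftP ord0 i) => [j|] ->; rewrite ?cconsS ?ccons0 !mxE.
Qed.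

(** Deflation: a unit eigenvector, completed to an orthonormal basis, makes [A] block diagonal with
    corner [x]. The roots of the corner and of the smaller block, rotated back, give the root of
    [A]. *)
Lemma posdef_sqrt (R : realType) m (A : 'M[R]_m) : posdef A ->
  exists T, posdef T /\ T *m T = A.
Proof.
elim: m A => [|m IH] A pA; first by exists A; split=> //; apply/matrixP => -[].
have [x [v [v0 Av]]] := symmetric_eigen (proj1 pA).
pose r := Num.sqrt (nsq v); have nv : 0 < nsq v.
  by rewrite lt_neqAle nsq_ge0 andbT eq_sym; apply: contra v0 => /eqP/nsq_eq0 ->.
have rr : r * r = nsq v by rewrite -expr2 sqr_sqrtr // ltW.
have r0 : r != 0 by rewrite gt_eqF // sqrtr_gt0.
pose N := r^-1 *: v^T.
have NN : N *m N^T = 1%:M.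
  rewrite /N linearZ /= trmxK -scalemxAl -scalemxAr scalerA -invfM rr.
  by rewrite [v^T *m v]mx11_scalar -nsqE -mul_scalar_mx -scalar_mxM mulVf // gt_eqF.
have NA : N *m A = x *: N.
  have NT : N^T = r^-1 *: v by rewrite /N linearZ /= trmxK.
  apply: trmx_inj; rewrite trmx_mul (proj1 pA) [in RHS]linearZ /= NT -scalemxAr Av.
  by rewrite !scalerA mulrC.
clearbody N.
have [j [G [jE GG NG]]] := orthonormal_completion NN.
have {jE} jE : m = j by case: jE.
move: G GG NG; rewrite -jE => G GG NG.
pose O : 'M[R]_m.+1 := col_mx N G.
have tO : O^T = row_mx N^T G^T by exact: (tr_col_mx N G).
have OO : O *m O^T = 1%:M.
  apply: (etrans (_ : _ = block_mx (N *m N^T) (N *m G^T) (G *m N^T) (G *m G^T) )).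
    by rewrite tO; exact: mul_col_row.
  rewrite NN NG GG (_ : G *m N^T = 0); last by apply: trmx_inj; rewrite trmx_mul trmxK NG trmx0.
  exact/esym/(scalar_mx_block 1 m (1 : R)).
have uO : O \in unitmx by case/mulmx1_unit: OO.
have OO' : O^T *m O = 1%:M by apply: mulmx1C.
have uOT : O^T \in unitmx by rewrite unitmx_tr.
have pB := posdef_conj pA uOT; rewrite trmxK in pB.
have BE : O *m A *m O^T = cblock x 0 0 (G *m A *m G^T).
  apply: (etrans (_ : _ = block_mx (N *m A *m N^T) (N *m A *m G^T) (G *m A *m N^T) (G *m A *m G^T) )).
    by rewrite tO (mul_col_mx N G A : O *m A = _); exact: mul_col_row.
  have AN : A *m N^T = x *: N^T by apply: trmx_inj; rewrite trmx_mul trmxK (proj1 pA) NA [in RHS]linearZ /= trmxK.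
  rewrite NA -!scalemxAl NN NG scaler0 -mulmxA AN -scalemxAr.
  rewrite (_ : G *m N^T = 0) ?scaler0 ?scalemx1 //.
  by apply: trmx_inj; rewrite trmx_mul trmxK NG trmx0.
rewrite BE in pB; have [_ x0 _ pD] := posdef_cblock pB.
have [T [pT TT]] : exists T, posdef T /\ T *m T = G *m A *m G^T.
  by apply: IH; move: pD; rewrite mul0mx scaler0 subr0.
exists (O^T *m cblock (Num.sqrt x) 0 0 T *m O); split.
  by apply: posdef_conj => //; apply: posdef_cblock0; rewrite ?sqrtr_gt0.
rewrite -!mulmxA (mulmxA O) OO mul1mx (mulmxA (cblock _ _ _ _)) cblockM.
rewrite !mul0mx !mulmx0 [(0 : 'M[R]_1) 0 0]mxE !scaler0 !addr0 -expr2 sqr_sqrtr ?ltW //.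
by rewrite add0r TT -BE !mulmxA OO' mul1mx -mulmxA OO' mulmx1.
Qed.

Lemma sqrtmP (R : realType) m (A : 'M[R]_m) : posdef A ->
  posdef (sqrtm A) /\ sqrtm A *m sqrtm A = A.
Proof. by move=> /posdef_sqrt; exact: xgetPex. Qed.

Lemma orthogonal_det (R : realType) m (O : 'M[R]_m) : O *m O^T = 1%:M -> `|\det O| = 1.
Proof.
move=> /(congr1 determinant); rewrite det_mulmx det_tr det1 => dd.
by apply/eqP; rewrite -(@eqrXn2 _ 2) // -normrX expr2 dd normr1 expr1n.
Qed.

Lemma nsq_orthogonal (R : realType) m n (O : 'M[R]_(m, n)) (v : 'cV[R]_n) :
  O^T *m O = 1%:M -> nsq (O *m v) = nsq v.
Proof. by move=> OO; rewrite !nsqE trmx_mul mulmxA -(mulmxA v^T) OO mulmx1. Qed.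

(** Completing [N] to an orthogonal matrix preserves the Gaussian density, a function of the norm
    alone; the added coordinates integrate to 1. This removes the sample size from the dimension of
    the noise. *)
Lemma gauss_marginal (R : realType) (s : R) k n (N : 'M[R]_(k, n)) (F : 'cV[R]_k -> \bar R) :
  s != 0 -> N *m N^T = 1%:M -> mcol F -> (forall v, 0 <= F v)%E ->
  colint (fun u => F (N *m u) * (gpdf s u)%:E)%E = colint (fun v => F v * (gpdf s v)%:E)%E.
Proof.
move=> s0 NN mF F0; have [j [G [nE GG NG]]] := orthonormal_completion NN.
subst n; pose O := col_mx N G.
have OO : O *m O^T = 1%:M.
  rewrite /O tr_col_mx mul_col_row NN NG GG.
  rewrite (_ : G *m N^T = 0) -?scalar_mx_block //.
  by apply: trmx_inj; rewrite trmx_mul trmxK NG trmx0.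
pose K (w : 'cV[R]_(k + j)) : \bar R := (F (usubmx w) * (gpdf s w)%:E)%E.
have mK : mcol K.
  apply: emeasurable_funM; first exact: (mcol_comp mF (mmap_usubmx (@mmap_id R (k + j)))).
  by apply/measurable_EFinP; exact: (mcol_gpdf s (@mmap_id R (k + j))).
have K0 w : (0 <= K w)%E by rewrite mule_ge0 // lee_fin gpdf_ge0.
have uO : O \in unitmx by case/mulmx1_unit: OO.
transitivity (colint K).
  rewrite -(colint_affine 0 uO mK K0) orthogonal_det // mul1e.
  congr colint; apply/funext => u; rewrite /K addr0 mul_col_mx col_mxKu; congr (_ * _%:E)%E.
  by rewrite !gpdfE // -mul_col_mx nsq_orthogonal // mulmx1C.
apply: (etrans (colint_cat mK K0)); congr colint; apply/funext => v.
transitivity (colint (fun b : 'cV[R]_j => (F v * (gpdf s v)%:E) * (gpdf s b)%:E)%E).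
  by congr colint; apply/funext => b; rewrite /K col_mxKu gpdf_col_mx EFinM muleA.
have mg := mcol_gpdf s (@mmap_id R j).
rewrite {1}/colint ge0_integralZl //; last 3 first.
- exact/measurable_EFinP.
- by move=> t _; rewrite lee_fin gpdf_ge0.
- by rewrite mule_ge0 // lee_fin gpdf_ge0.
by have := colint_gpdf j s0; rewrite /colint => ->; rewrite mule1.
Qed.

(** * Limits of densities *)

(** [g n] is the positive part of [f - f_ n]. It is dominated by [f], so its integral tends to 0,
    and since [f] and [f_ n] have equal mass the L1 distance is twice this integral. *)
Lemma scheffe d (T : measurableType d) (R : realType) (mu : {measure set T -> \bar R})
    (f_ : nat -> T -> R) (f : T -> R) :
  (forall n, measurable_fun setT (f_ n)) -> measurable_fun setT f ->
  (forall n x, 0 <= f_ n x) -> (forall x, 0 <= f x) ->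
  (\int[mu]_x (f x)%:E = 1)%E ->
  (\forall n \near \oo, (\int[mu]_x (f_ n x)%:E = 1)%E) ->
  (forall x, f_ n x @[n --> \oo] --> f x) ->
  (\int[mu]_x `|f_ n x - f x|%:E)%E @[n --> \oo] --> 0%E.
Proof.
move=> mf_ mf f_0 f0 f1 f_1 cf; pose g n x := 2^-1 * (f x - f_ n x + `|f_ n x - f x|).
have mb n : measurable_fun setT (fun x => `|f_ n x - f x|).
  by apply: measurableT_comp => //; exact: measurable_funB.
have mg n : measurable_fun setT (g n).
  by apply: measurable_funM => //; apply: measurable_funD => //; exact: measurable_funB.
have g0 n x : 0 <= g n x.
  by rewrite mulr_ge0 // -[f x - _]opprB addrC subr_ge0 ler_norm.
have gf n x : g n x <= f x.
  have := f0 x; have := f_0 n x; rewrite /g => h1 h2.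
  by have [h|h] := leP 0 (f_ n x - f x); [rewrite ger0_norm|rewrite ltr0_norm] => //; lra.
have If : mu.-integrable setT (EFin \o f).
  apply/integrableP; split; first exact/measurable_EFinP.
  by under eq_integral do rewrite /= ger0_norm //; rewrite f1 ltry.
have [_ _ Ig] : [/\ mu.-integrable setT (cst 0%E),
   [sequence \int[mu]_x `|(g n x)%:E - 0%E|]_n @ \oo --> 0%E &
   [sequence \int[mu]_x (g n x)%:E]_n @ \oo --> \int[mu]_x (cst 0 x)]%E.
  apply: (@dominated_convergence _ _ _ mu setT measurableT
     (fun n x => (g n x)%:E) (cst 0%E) (EFin \o f)) => //.
  - by move=> n; exact/measurable_EFinP.
  - apply: aeW => x _; apply: cvg_EFin; first by near=> n.
    rewrite -[X in _ --> X](mulr0 2^-1); apply: cvgM; first exact: cvg_cst.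
    have -> : (0 : R) = (f x - f x) + `|f x - f x| by rewrite subrr normr0 addr0.
    apply: cvgD; first by apply: cvgB; [exact: cvg_cst|exact: cf].
    by apply: cvg_norm; apply: cvgB; [exact: cf|exact: cvg_cst].
  - by apply: aeW => x n _; rewrite /= lee_fin ger0_norm.
have {}Ig : (2%:E * \int[mu]_x (g n x)%:E)%E @[n --> \oo] --> 0%E.
  rewrite -(mule0 2%:E); apply: cvgeZl => //.
  by move: Ig; rewrite integral0.
apply: cvg_trans Ig; apply: near_eq_cvg; near=> n.
have f_n1 : (\int[mu]_x (f_ n x)%:E = 1)%E by near: n.
have : (\int[mu]_x (f x)%:E + \int[mu]_x `|f_ n x - f x|%:E =
       \int[mu]_x (f_ n x)%:E + 2%:E * \int[mu]_x (g n x)%:E)%E.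
  rewrite -ge0_integralZl_EFin //; last 2 first.
  - by move=> x _; rewrite lee_fin.
  - exact/measurable_EFinP.
  rewrite -!ge0_integralD //.
  - apply: eq_integral => x _; rewrite -EFinM -!EFinD; congr EFin.
    by rewrite /g; field.
  - by move=> x _; rewrite lee_fin.
  - exact/measurable_EFinP.
  - by move=> x _; rewrite lee_fin mulr_ge0.
  - by apply/measurable_EFinP; exact: measurable_funM.
  - by move=> x _; rewrite lee_fin.
  - exact/measurable_EFinP.
  - exact/measurable_EFinP.
rewrite f1 f_n1 => /(congr1 (fun e => e - 1%:E)%E).
by rewrite ![(1 + _)%E]addeC !addeK.
Unshelve. all: by end_near.
Qed.

(** Entrywise convergence, which reduces products, determinants and Cholesky factors to limits of
    real sequences. *)
Definition mcvg (R : realType) m n (A_ : nat -> 'M[R]_(m, n)) (A : 'M[R]_(m, n)) :=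
  forall i j, A_ k i j @[k --> \oo] --> A i j.

Lemma cvg_mcvg (R : realType) m n (A_ : nat -> 'M[R]_(m, n)) (A : 'M[R]_(m, n)) :
  A_ k @[k --> \oo] --> A -> mcvg A_ A.
Proof.
by move=> cA i j; exact: (continuous_cvg _ (@coord_continuous R m n i j A) cA).
Qed.

Lemma cvg_sumR (R : realType) (I : Type) (r : seq I) (P : pred I) (f : I -> nat -> R) (l : I -> R) :
  (forall i, f i k @[k --> \oo] --> l i) ->
  \sum_(i <- r | P i) f i k @[k --> \oo] --> \sum_(i <- r | P i) l i.
Proof.
move=> fl; elim: r => [|i r IH].
  by under eq_fun do rewrite big_nil; rewrite big_nil; exact: cvg_cst.
under eq_fun do rewrite big_cons; rewrite big_cons; case: (P i) => //.
exact: cvgD.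
Qed.

Lemma cvg_prodR (R : realType) (I : Type) (r : seq I) (P : pred I) (f : I -> nat -> R) (l : I -> R) :
  (forall i, f i k @[k --> \oo] --> l i) ->
  \prod_(i <- r | P i) f i k @[k --> \oo] --> \prod_(i <- r | P i) l i.
Proof.
move=> fl; elim: r => [|i r IH].
  by under eq_fun do rewrite big_nil; rewrite big_nil; exact: cvg_cst.
under eq_fun do rewrite big_cons; rewrite big_cons; case: (P i) => //.
exact: cvgM.
Qed.

Section mcvg.
Variable R : realType.

Lemma mcvg_cst m n (A : 'M[R]_(m, n)) : mcvg (fun=> A) A.
Proof. by move=> i j; exact: cvg_cst. Qed.

Lemma mcvgM m n p (A_ : nat -> 'M[R]_(m, n)) A (B_ : nat -> 'M[R]_(n, p)) B :
  mcvg A_ A -> mcvg B_ B -> mcvg (fun k => A_ k *m B_ k) (A *m B).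
Proof.
move=> cA cB i j; under eq_fun do rewrite mxE; rewrite mxE.
by apply: cvg_sumR => l; apply: cvgM; [exact: cA|exact: cB].
Qed.

Lemma mcvgD m n (A_ B_ : nat -> 'M[R]_(m, n)) A B :
  mcvg A_ A -> mcvg B_ B -> mcvg (fun k => A_ k + B_ k) (A + B).
Proof.
move=> cA cB i j; under eq_fun do rewrite mxE; rewrite mxE.
by apply: cvgD; [exact: cA|exact: cB].
Qed.

Lemma mcvgN m n (A_ : nat -> 'M[R]_(m, n)) A : mcvg A_ A -> mcvg (fun k => - A_ k) (- A).
Proof.
move=> cA i j; under eq_fun do rewrite mxE; rewrite mxE.
by apply: cvgN; exact: cA.
Qed.

Lemma mcvgB m n (A_ B_ : nat -> 'M[R]_(m, n)) A B :
  mcvg A_ A -> mcvg B_ B -> mcvg (fun k => A_ k - B_ k) (A - B).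
Proof. by move=> cA cB; apply: mcvgD => //; exact: mcvgN. Qed.

Lemma mcvgZ m n (x_ : nat -> R) (x : R) (A_ : nat -> 'M[R]_(m, n)) A :
  x_ k @[k --> \oo] --> x -> mcvg A_ A -> mcvg (fun k => x_ k *: A_ k) (x *: A).
Proof.
move=> cx cA i j; under eq_fun do rewrite mxE; rewrite mxE.
by apply: cvgM => //; exact: cA.
Qed.

Lemma mcvg_tr m n (A_ : nat -> 'M[R]_(m, n)) A : mcvg A_ A -> mcvg (fun k => (A_ k)^T) A^T.
Proof. by move=> cA i j; under eq_fun do rewrite mxE; rewrite mxE; exact: cA. Qed.

Lemma mcvg_usubmx m1 m2 n (A_ : nat -> 'M[R]_(m1 + m2, n)) A :
  mcvg A_ A -> mcvg (fun k => usubmx (A_ k)) (usubmx A).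
Proof. by move=> cA i j; under eq_fun do rewrite mxE; rewrite mxE; exact: cA. Qed.

Lemma mcvg_dsubmx m1 m2 n (A_ : nat -> 'M[R]_(m1 + m2, n)) A :
  mcvg A_ A -> mcvg (fun k => dsubmx (A_ k)) (dsubmx A).
Proof. by move=> cA i j; under eq_fun do rewrite mxE; rewrite mxE; exact: cA. Qed.

Lemma mcvg_rsubmx m n1 n2 (A_ : nat -> 'M[R]_(m, n1 + n2)) A :
  mcvg A_ A -> mcvg (fun k => rsubmx (A_ k)) (rsubmx A).
Proof. by move=> cA i j; under eq_fun do rewrite mxE; rewrite mxE; exact: cA. Qed.

Lemma cvg_det m (A_ : nat -> 'M[R]_m) A : mcvg A_ A -> \det (A_ k) @[k --> \oo] --> \det A.
Proof.
move=> cA; apply: cvg_sumR => p; apply: cvgM; first exact: cvg_cst.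
by apply: cvg_prodR => i; exact: cA.
Qed.

Lemma cvg_nsq m (v_ : nat -> 'cV[R]_m) v : mcvg v_ v -> nsq (v_ k) @[k --> \oo] --> nsq v.
Proof. by move=> cv; apply: cvg_sumR => i; apply: cvgM; exact: cv. Qed.

Lemma cvg_gpdf (s : R) m (v_ : nat -> 'cV[R]_m) v : s != 0 ->
  mcvg v_ v -> gpdf s (v_ k) @[k --> \oo] --> gpdf s v.
Proof.
move=> s0 cv; apply: cvg_prodR => i.
exact: (continuous_cvg _ (continuous_normal_pdf s0 (x := v i 0)) (cv i 0)).
Qed.

Lemma mcvg_cblock m a_ (a : R) b_ b c_ c (D_ : nat -> 'M[R]_m) D :
  a_ k @[k --> \oo] --> a -> mcvg b_ b -> mcvg c_ c -> mcvg D_ D ->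
  mcvg (fun k => cblock (a_ k) (b_ k) (c_ k) (D_ k)) (cblock a b c D).
Proof.
move=> ca cb cc cD i j.
have Eul x (b' : 'rV[R]_m) c' D' (i' j' : 'I_1) :
    cblock x b' c' D' (lshift m i') (lshift m j') = x.
  by have := block_mxEul (x%:M : 'M[R]_1) b' c' D' i' j'; rewrite [RHS]mxE !ord1 eqxx mulr1n.
have Eur x (b' : 'rV[R]_m) c' D' (i' : 'I_1) j' :
    cblock x b' c' D' (lshift m i') (rshift 1 j') = b' i' j'.
  exact: block_mxEur.
have Edl x (b' : 'rV[R]_m) c' D' i' (j' : 'I_1) :
    cblock x b' c' D' (rshift 1 i') (lshift m j') = c' i' j'.
  exact: block_mxEdl.
have Edr x (b' : 'rV[R]_m) c' D' i' j' :
    cblock x b' c' D' (rshift 1 i') (rshift 1 j') = D' i' j'.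
  exact: block_mxEdr.
case: (@split_ordP 1 m i) => i' ->; case: (@split_ordP 1 m j) => j' ->.
- by under eq_fun do rewrite Eul; rewrite Eul.
- by under eq_fun do rewrite Eur; rewrite Eur; exact: cb.
- by under eq_fun do rewrite Edl; rewrite Edl; exact: cc.
- by under eq_fun do rewrite Edr; rewrite Edr; exact: cD.
Qed.

(** The pivot of the limit is positive, so its root and the reciprocals are continuous there; the
    Schur complements converge to a positive definite one and the induction goes on. *)
Lemma mcvg_chol m (A_ : nat -> 'M[R]_m) A : posdef A -> mcvg A_ A ->
  mcvg (fun k => chol (A_ k)) (chol A).
Proof.
elim: m A_ A => [|m IH] A_ A pA cA; first by case.
pose A' : 'M[R]_(1 + m) := A.
have AE : A = cblock (A ord0 ord0) (ursubmx A') (dlsubmx A') (drsubmx A').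
  rewrite /cblock (_ : (A ord0 ord0)%:M = ulsubmx A') ?submxK //.
  rewrite [RHS]mx11_scalar; congr (_%:M); rewrite !mxE.
  by congr (A _ _); exact/val_inj.
have [_ a0 _ pS] : [/\ ursubmx A' = (dlsubmx A')^T, 0 < A ord0 ord0,
    (drsubmx A')^T = drsubmx A' &
    posdef (drsubmx A' - (A ord0 ord0)^-1 *: (dlsubmx A' *m (dlsubmx A')^T))].
  by apply: posdef_cblock; rewrite -AE.
have cc : mcvg (fun k => dlsubmx (A_ k : 'M[R]_(1 + m))) (dlsubmx A').
  by move=> i j; under eq_fun do rewrite !mxE; rewrite !mxE; exact: cA.
have cD : mcvg (fun k => drsubmx (A_ k : 'M[R]_(1 + m))) (drsubmx A').
  by move=> i j; under eq_fun do rewrite !mxE; rewrite !mxE; exact: cA.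
have cV : (A_ k ord0 ord0)^-1 @[k --> \oo] --> (A ord0 ord0)^-1.
  by apply: cvgV; [rewrite gt_eqF|exact: cA].
have cs : Num.sqrt (A_ k ord0 ord0) @[k --> \oo] --> Num.sqrt (A ord0 ord0).
  exact: (continuous_cvg _ (@sqrt_continuous R (A ord0 ord0)) (cA ord0 ord0)).
apply: mcvg_cblock => //.
- exact: mcvg_cst.
- by apply: mcvgZ => //; apply: cvgV => //; rewrite gt_eqF // sqrtr_gt0.
- apply: IH => //; apply: mcvgB => //; apply: mcvgZ => //.
  by apply: mcvgM => //; exact: mcvg_tr.
Qed.

End mcvg.

(** * Pointwise convergence of the densities *)

Section cvg_fdens.
Variables (R : realType) (kap a s : R) (k1 k2 : nat).
Hypotheses (kap0 : 0 < kap) (a0 : 0 < a) (s0 : s != 0).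

Lemma mcvg_emap m (v_ : nat -> 'cV[R]_m) v : mcvg v_ v ->
  mcvg (fun k => emap kap a (v_ k)) (emap kap a v).
Proof.
move=> cv; apply: mcvgZ => //.
exact: (continuous_cvg _ (continuous_escale kap0 a0 (x := nsq v)) (cvg_nsq cv)).
Qed.

Lemma cvg_rjac m (v_ : nat -> 'cV[R]_m) v : mcvg v_ v ->
  rjac kap a (v_ k) @[k --> \oo] --> rjac kap a v.
Proof.
move=> cv.
have c : continuous (fun q : R => shrink kap a q ^+ m.-1 * shrinkJ kap a q).
  move=> q; apply: cvgM; last exact: continuous_shrinkJ.
  apply: (@continuous_comp _ _ _ (shrink kap a) (fun x => x ^+ m.-1)).
    exact: continuous_shrink.
  exact: exprn_continuous.
exact: (continuous_cvg _ (c (nsq v)) (cvg_nsq cv)).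
Qed.

Lemma cvg_fdens (U_ : nat -> 'M[R]_(k1 + k2)) U (c_ : nat -> 'cV[R]_k2) c t :
  mcvg U_ U -> mcvg c_ c ->
  fdens kap a s (U_ k) (c_ k) t @[k --> \oo] --> fdens kap a s U c t.
Proof.
move=> cU cc; have cy := mcvgM cU (@mcvg_cst R _ _ t).
have ce := mcvg_emap (mcvgD (mcvg_dsubmx cy) cc).
apply: cvgM; first by apply: cvg_norm; exact: cvg_det.
apply: cvgM; first by apply: cvg_gpdf => //; exact: mcvg_usubmx.
apply: cvgM; first by apply: cvg_gpdf => //; exact: mcvgB.
by apply: cvgV; [rewrite gt_eqF // rjac_gt0|exact: cvg_rjac].
Qed.

Lemma cvg_expR_decay (q_ : nat -> R) : q_ k @[k --> \oo] --> +oo ->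
  (1 + q_ k) * expR (- (a * q_ k)) @[k --> \oo] --> 0.
Proof.
(* Chosen so that [b (1 + q) <= 1 + a q / 2 <= exp (a q / 2)]; squaring gives
   [(1 + q) exp (- a q) <= 1 / (b^2 (1 + q))]. *)
move=> cq; pose b := Num.min 1 (a / 2).
have b0 : 0 < b by rewrite lt_min ltr01 divr_gt0.
have c1 : (b ^+ 2 * (1 + q_ k))^-1 @[k --> \oo] --> 0.
  apply/gtr0_cvgV0.
    have /cvgryPge/(_ 0) := cq; apply: filterS => k qk.
    by rewrite mulr_gt0 ?exprn_gt0 // ltr_wpDr.
  apply/cvgryPge => A; have /cvgryPge/(_ (A / b ^+ 2)) := cq; apply: filterS => k.
  rewrite ler_pdivrMr ?exprn_gt0 // mulrC => h; apply: (le_trans h).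
  by rewrite ler_pM2l ?exprn_gt0 // lerDr.
apply: (@squeeze_cvgr _ _ _ _ (fun=> 0) _ _ _ _ _ c1); last exact: cvg_cst.
have /cvgryPge/(_ 0) := cq; apply: filterS => k qk.
have q1 : 0 < 1 + q_ k by rewrite ltr_wpDr.
apply/andP; split; first by rewrite mulr_ge0 ?expR_ge0 // ltW.
have b2 : 0 < b ^+ 2 by rewrite exprn_gt0.
rewrite expRN ler_pdivrMr ?expR_gt0 // mulrC ler_pdivlMr ?mulr_gt0 //.
rewrite mulrCA -expr2 -exprMn.
have -> : a * q_ k = a * q_ k / 2 + a * q_ k / 2 by lra.
rewrite expRD -expr2 lerXn2r ?nnegrE ?expR_ge0 //; first by rewrite mulr_ge0 // ltW.
apply: le_trans (expR_ge1Dx _).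
rewrite mulrDr mulr1; apply: lerD; first by rewrite ge_min lexx.
by rewrite mulrAC ler_wpM2r // ge_min lexx orbT.
Qed.

(** With [w = y + c] and [q] the squared norm of its preimage, [emap w - w] equals
    [kap exp (- a q) w]. As [q] dominates [|w|^2], each entry is at most [kap (1 + q) exp (- a q)]
    in absolute value, which tends to 0; the weight and the Jacobian at the preimage tend to 1. *)
Lemma cvg_fdens_infty (U_ : nat -> 'M[R]_(k1 + k2)) U (c_ : nat -> 'cV[R]_k2) t :
  mcvg U_ U -> enorm (c_ k) @[k --> \oo] --> +oo ->
  fdens kap a s (U_ k) (c_ k) t @[k --> \oo] --> `|\det U| * gpdf s (U *m t).
Proof.
move=> cU cc; have cy := mcvgM cU (@mcvg_cst R _ _ t).
pose y k := dsubmx (U_ k *m t); pose w k := y k + c_ k.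
pose q k := rexpand kap a (enorm (w k)) ^+ 2.
have wq k : nsq (w k) <= q k.
  rewrite -[nsq (w k)](sqr_sqrtr (nsq_ge0 _)) lerXn2r ?nnegrE ?sqrtr_ge0 //.
    exact: le_trans (rexpand_ge kap0 a0 (sqrtr_ge0 _)).
  exact: rexpand_ge.
have cq : q k @[k --> \oo] --> +oo.
  apply/cvgryPge => A; have cny := cvg_nsq (mcvg_dsubmx cy).
  set l := nsq (dsubmx (U *m t)) in cny.
  near=> k; apply: le_trans (wq k).
  have h1 : nsq (y k) <= l + 1.
    near: k; have /cvgrPdist_le/(_ 1 ltr01) := cny; apply: filterS => k.
    by rewrite ler_distlC => /andP[].
  (* The final [+ 1] ensures that the norm of [c_ k] is at least 1, hence at most its square; the
     rest absorbs [|y|^2 <= l + 1]. *)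
  have h2 : 2 * (`|A| + l + 1) + 1 <= enorm (c_ k) by near: k; move/cvgryPge : cc; exact.
  have h3 : nsq (c_ k) <= 2 * nsq (w k) + 2 * nsq (y k).
    rewrite /nsq !mulr_sumr -big_split /=; apply: ler_sum => i _.
    have -> : c_ k i 0 = w k i 0 - y k i 0 by rewrite /w [X in _ = X - _]addmxE addrAC subrr add0r.
    by have := sqr_ge0 (w k i 0 + y k i 0); rewrite !expr2; nra.
  have h4 : enorm (c_ k) <= nsq (c_ k).
    rewrite -[nsq _](sqr_sqrtr (nsq_ge0 _)) -/(enorm (c_ k)) expr2 ler_peMl ?sqrtr_ge0 //.
    apply: le_trans h2; rewrite lerDr mulr_ge0 // addr_ge0 // addr_ge0 //.
    exact: nsq_ge0.
  have := ler_norm A; lra.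
have cd := cvg_expR_decay cq.
have ce : expR (- (a * q k)) @[k --> \oo] --> 0.
  apply: (@squeeze_cvgr _ _ _ _ (fun=> 0) _ _ _ _ _ cd); last exact: cvg_cst.
  have /cvgryPge/(_ 0) := cq; apply: filterS => k qk.
  by rewrite expR_ge0 /= ler_peMl ?expR_ge0 // lerDl.
have cqe : q k * expR (- (a * q k)) @[k --> \oo] --> 0.
  have -> : (fun k => q k * expR (- (a * q k))) =
    (fun k => (1 + q k) * expR (- (a * q k)) - expR (- (a * q k))).
    by apply/funext => k; ring.
  by rewrite -[X in _ --> X](subrr (0 : R)); exact: cvgB.
have cH : shrink kap a (q k) @[k --> \oo] --> (1 : R).
  rewrite -[X in _ --> X](@invr1 R); apply: cvgV; first exact: oner_neq0.
  rewrite -[X in _ --> X](addr0 (1 : R)) -(mulr0 kap).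
  by apply: cvgD; [exact: cvg_cst|apply: cvgM => //; exact: cvg_cst].
have cJ : shrinkJ kap a (q k) @[k --> \oo] --> (1 : R).
  rewrite -[X in _ --> X](addr0 (1 : R)); apply: cvgD => //.
  rewrite (_ : (fun k => _) = (fun k => 2 * a * kap * (q k * expR (- (a * q k))) * shrink kap a (q k) ^+ 2)); last by apply/funext => k; ring.
  rewrite -[X in _ --> X](mul0r ((1 : R) ^+ 2)) -(mulr0 (2 * a * kap)).
  by apply: cvgM; [apply: cvgM => //; exact: cvg_cst|apply: cvgM].
apply: cvgM; first by apply: cvg_norm; exact: cvg_det.
rewrite -[U *m t]vsubmxK gpdf_col_mx.
apply: cvgM; first by apply: cvg_gpdf => //; exact: mcvg_usubmx.
have cJ' : rjac kap a (emap kap a (w k)) @[k --> \oo] --> (1 : R).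
  have -> : (fun k => rjac kap a (emap kap a (w k))) =
      (fun k => shrink kap a (q k) ^+ k2.-1 * shrinkJ kap a (q k)).
    by apply/funext => k; rewrite /rjac nsq_emap.
  rewrite -[X in _ --> X](mulr1 (1 : R)); apply: cvgM => //.
  rewrite -(expr1n R k2.-1).
  exact: (continuous_cvg _ (@exprn_continuous R k2.-1 1) cH).
rewrite -[X in _ --> X]mulr1 -[X in _ * X]invr1; apply: cvgM; last first.
  by apply: cvgV; first exact: oner_neq0.
apply: cvg_gpdf => //.
have -> : (fun k => emap kap a (dsubmx (U_ k *m t) + c_ k) - c_ k) =
   (fun k => y k + (kap * expR (- (a * q k))) *: w k).
  apply/funext => k; rewrite /emap -/(w k) -/(y k) -/(q k) invrK scalerDl scale1r.
  by rewrite addrAC; congr (_ + _); rewrite /w addrK.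
rewrite -[X in mcvg _ X](addr0 (dsubmx (U *m t))); apply: mcvgD; first exact: mcvg_dsubmx.
move=> i j; rewrite mxE; apply/norm_cvg0P.
apply: (@squeeze_cvgr _ _ _ _ (fun=> 0) (fun k => kap * ((1 + q k) * expR (- (a * q k))))).
- apply: nearW => k; rewrite normr_ge0 /= scalemxE normrM ord1.
  rewrite ger0_norm; last by rewrite mulr_ge0 ?expR_ge0 // ltW.
  rewrite -mulrA ler_wpM2l ?(ltW kap0) // mulrC ler_wpM2r ?expR_ge0 //.
  apply: le_trans (_ : 1 + nsq (w k) <= _); last by rewrite lerD2l.
  apply: le_trans (_ : 1 + w k i 0 ^+ 2 <= _).
    have := sqr_ge0 (`|w k i 0| - 1); rewrite -[w k i 0 ^+ 2]real_normK ?num_real //.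
    by have := normr_ge0 (w k i 0); rewrite !expr2; nra.
  rewrite lerD2l /nsq (bigD1 i) //= lerDl; apply: sumr_ge0 => l _; exact: sqr_ge0.
- exact: cvg_cst.
- by rewrite -(mulr0 kap); apply: cvgM => //; exact: cvg_cst.
Unshelve. all: by end_near.
Qed.

End cvg_fdens.

(** * From pointwise convergence to L1 and total variation *)

Section total_variation.
Variables (R : realType) (m N : nat).
Variables (P_ : nat -> set (Rn R m) -> \bar R) (P : set (Rn R m) -> \bar R).
Variables (g_ : nat -> Rn R m -> R) (g : Rn R m -> R).
Local Notation mu := (lebn R m).
Hypotheses (mg_ : forall n, measurable_fun setT (g_ n)) (mg : measurable_fun setT g).
Hypotheses (g_0 : forall n t, 0 <= g_ n t) (g0 : forall t, 0 <= g t).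
Hypothesis Pg_ : forall n A, (N <= n)%N -> measurable A ->
  P_ n A = (\int[mu]_t ((\1_A t : R) * g_ n t)%:E)%E.
Hypothesis Pg : forall A, measurable A -> P A = (\int[mu]_t ((\1_A t : R) * g t)%:E)%E.
Hypotheses (g_1 : forall n, (N <= n)%N -> (\int[mu]_t (g_ n t)%:E = 1)%E)
  (g1 : (\int[mu]_t (g t)%:E = 1)%E).
Hypothesis cg : forall t, g_ n t @[n --> \oo] --> g t.

Let near_N (Q : nat -> Prop) : (forall n, (N <= n)%N -> Q n) -> \forall n \near \oo, Q n.
Proof. by move=> NQ; exists N => // n; exact: NQ. Qed.

Let L1_cvg : (\int[mu]_t `|g_ n t - g t|%:E)%E @[n --> \oo] --> 0%E.
Proof. by apply: scheffe => //; exact: near_N. Qed.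

Let indic_prod_meas (A : set (Rn R m)) (h : Rn R m -> R) : measurable A ->
  measurable_fun setT h -> measurable_fun setT (fun t => ((\1_A t : R) * h t)%:E).
Proof. by move=> mA mh; apply/measurable_EFinP; apply: measurable_funM. Qed.

(** Both functions integrate to [Q A] over every measurable [A], and the first one is integrable. *)
Lemma density_ae (h f : Rn R m -> R) (Q : set (Rn R m) -> \bar R) :
  measurable_fun setT h -> (forall t, 0 <= h t) -> (\int[mu]_t (h t)%:E = 1)%E ->
  (forall A, measurable A -> Q A = (\int[mu]_t ((\1_A t : R) * h t)%:E)%E) ->
  is_density Q f -> ae_eq mu setT (EFin \o h) (EFin \o f).
Proof.
move=> mh h0 h1 Qh [mf [f0 Qf]].
apply: integral_ae_eq => //.
- apply/integrableP; split; first exact/measurable_EFinP.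
  by under eq_integral do rewrite /= ger0_norm //; rewrite h1 ltry.
- exact/measurable_EFinP.
- move=> E _ mE; have := Qf E mE; rewrite Qh // leb_intE; last 2 first.
  + exact: indic_prod_meas.
  + by move=> t; rewrite lee_fin mulr_ge0.
  have aux (k : Rn R m -> R) : (\int[mu]_t ((\1_E t : R) * k t)%:E)%E =
      (\int[mu]_t ((EFin \o k) \_ E) t)%E.
    by apply: eq_integral => t _; rewrite patchE indicE; case: ifP => _; rewrite ?mul1r ?mul0r.
  by rewrite !aux !(integral_mkcond E).
Qed.

(* A density is determined almost everywhere by the law, so the given ones may be
   replaced by [g_ n] and [g]. *)
Lemma L1_convergence (f_ : nat -> Rn R m -> R) (f : Rn R m -> R) :
  (forall n, (N <= n)%N -> is_density (P_ n) (f_ n)) -> is_density P f ->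
  leb_int (fun t => `|f_ n t - f t|%:E) @[n --> \oo] --> 0%E.
Proof.
move=> df_ df; apply: cvg_trans L1_cvg; apply: near_eq_cvg; apply: near_N => n Nn.
have [mf_ [f_0 _]] := df_ n Nn; have [mf [f0 _]] := df.
have mabs (h k : Rn R m -> R) : measurable_fun setT h -> measurable_fun setT k ->
    measurable_fun setT (fun t => `|h t - k t|%:E).
  move=> mh mk; apply/measurable_EFinP; apply: measurableT_comp => //; exact: measurable_funB.
rewrite leb_intE; [|exact: mabs|by move=> t; rewrite lee_fin].
apply: (ge0_ae_eq_integral measurableT (mabs _ _ (mg_ n) mg) (mabs _ _ mf_ mf)).
- by move=> t _; rewrite lee_fin.
- by move=> t _; rewrite lee_fin.
have A1 := density_ae (mg_ n) (g_0 n) (g_1 Nn) (fun A => @Pg_ n A Nn) (df_ n Nn).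
have A2 := density_ae mg g0 g1 Pg df.
by apply: filterS2 A1 A2 => t h1 h2 _; have [->] := h1 I; have [->] := h2 I.
Qed.

(** The difference of the two probabilities of [A] is bounded by the L1 distance of the densities,
    which does not depend on [A]. *)
Lemma TV_convergence (eps : R) : 0 < eps -> \forall n \near \oo,
  forall A : set (Rn R m), measurable A -> (`| P_ n A - P A | < eps%:E)%E.
Proof.
move=> e0; have near_e : \forall n \near \oo, (\int[mu]_t `|g_ n t - g t|%:E < eps%:E)%E.
  exact: (L1_cvg (nbhs_open_ereal_lt (f := fun=> eps) e0)).
near=> n; have Nn : (N <= n)%N by near: n; exact: near_N.
have : (\int[mu]_t `|g_ n t - g t|%:E < eps%:E)%E by near: n.
move=> lt_e A mA; apply: le_lt_trans lt_e.
have mabs : measurable_fun setT (fun t => `|g_ n t - g t|%:E).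
  by apply/measurable_EFinP; apply: measurableT_comp => //; exact: measurable_funB.
have le1 (h : Rn R m -> R) : measurable_fun setT h -> (forall t, 0 <= h t) -> (\int[mu]_t (h t)%:E = 1)%E ->
   (\int[mu]_t ((\1_A t : R) * h t)%:E)%E \is a fin_num.
  move=> mh h0 h1; rewrite ge0_fin_numE; last first.
    by apply: integral_ge0 => t _; rewrite lee_fin mulr_ge0.
  apply: (@le_lt_trans _ _ 1%E); last exact: ltry.
  rewrite -h1; apply: ge0_le_integral => //.
  - by move=> t _; rewrite lee_fin mulr_ge0.
  - exact: indic_prod_meas.
  - exact/measurable_EFinP.
  - move=> t _; rewrite lee_fin ler_piMl // indicE; by case: (_ \in _).
have F_ : P_ n A \is a fin_num by rewrite Pg_ //; apply: le1 => //; exact: g_1.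
have F : P A \is a fin_num by rewrite Pg //; apply: le1.
(* One-sided bound, used with [g_ n] and [g] in both roles. *)
have half (h k : Rn R m -> R) : measurable_fun setT h -> measurable_fun setT k ->
   (forall t, 0 <= h t) -> (forall t, 0 <= k t) ->
   (forall t, `|h t - k t| = `|g_ n t - g t|) ->
   (\int[mu]_t ((\1_A t : R) * h t)%:E <= \int[mu]_t ((\1_A t : R) * k t)%:E +
      \int[mu]_t `|g_ n t - g t|%:E)%E.
  move=> mh mk h0 k0 E; rewrite -ge0_integralD //; last 2 first.
  - by move=> t _; rewrite lee_fin mulr_ge0.
  - exact: indic_prod_meas.
  apply: ge0_le_integral => //.
  - by move=> t _; rewrite lee_fin mulr_ge0.
  - exact: indic_prod_meas.
  - by apply: emeasurable_funD => //; exact: indic_prod_meas.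
  - move=> t _; rewrite -EFinD lee_fin -E indicE.
    case: (_ \in _); rewrite ?mul1r ?mul0r ?add0r //.
    by rewrite -lerBlDl ler_norm.
have I1 := half (g_ n) g (mg_ n) mg (g_0 n) g0 (fun=> erefl).
have I2 := half g (g_ n) mg (mg_ n) g0 (g_0 n) (fun t => distrC _ _).
rewrite -!Pg_ // -Pg // in I1 I2.
have fin_case (x y : R) (d : \bar R) : (x%:E <= y%:E + d -> y%:E <= x%:E + d -> `|x%:E - y%:E| <= d)%E.
  case: d => [d||]; rewrite ?leey // -!EFinD !lee_fin => xy yx.
  by rewrite ler_norml; apply/andP; split; lra.
by rewrite -(fineK F_) -(fineK F); apply: fin_case; rewrite !fineK.
Unshelve. all: by end_near.
Qed.

End total_variation.

Lemma invmx_mul (R : comUnitRingType) m (A B : 'M[R]_m) : A \in unitmx -> B \in unitmx ->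
  invmx (A *m B) = invmx B *m invmx A.
Proof.
move=> uA uB; have uAB : A *m B \in unitmx by rewrite unitmx_mul uA.
by rewrite -[RHS](mulKmx uAB) -mulmxA mulKVmx // mulmxV // mulmx1.
Qed.

(** * The estimators *)

Section block_posdef.
Variables (R : realType) (k1 k2 : nat).
Implicit Type Q : 'M[R]_(k1 + k2).

Lemma posdef_ulsubmx Q : posdef Q -> posdef (ulsubmx Q).
Proof.
move=> [Qs pos]; split; first by rewrite trmx_ulsub Qs.
move=> v v0; have := pos (col_mx v 0).
rewrite -{1}[Q]submxK tr_col_mx mul_row_block !trmx0 !mul0mx !addr0 mul_row_col mulmx0 addr0.
by apply; apply: contraNneq v0 => /(congr1 usubmx); rewrite col_mxKu linear0 => ->.
Qed.

Lemma posdef_drsubmx Q : posdef Q -> posdef (drsubmx Q).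
Proof.
move=> [Qs pos]; split; first by rewrite trmx_drsub Qs.
move=> v v0; have := pos (col_mx 0 v).
rewrite -{1}[Q]submxK tr_col_mx mul_row_block !trmx0 !mul0mx !add0r mul_row_col mulmx0 add0r.
by apply; apply: contraNneq v0 => /(congr1 dsubmx); rewrite col_mxKd linear0 => ->.
Qed.

Lemma posdef_tr_ursubmx Q : posdef Q -> (ursubmx Q)^T = dlsubmx Q.
Proof. by move=> [Qs _]; rewrite trmx_ursub Qs. Qed.

(** Block elimination: the congruence by the unipotent [E] has the Schur complement as its lower
    right block. *)
Lemma posdef_Schur Q : posdef Q -> posdef (Defs.Schur Q).
Proof.
move=> pQ; have u11 := posdef_unit (posdef_ulsubmx pQ).
have [t11 _] := posdef_ulsubmx pQ.
pose E : 'M[R]_(k1 + k2) := block_mx 1%:M (- (invmx (ulsubmx Q) *m ursubmx Q)) 0 1%:M.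
have uE : E \in unitmx by rewrite unitmxE det_ublock !det1 mulr1 unitr1.
have -> : Defs.Schur Q = drsubmx (E^T *m Q *m E); last exact/posdef_drsubmx/posdef_conj.
rewrite -{2}[Q]submxK /E tr_block_mx !mulmx_block block_mxKdr !trmx1 !mul1mx !mulmx1.
have -> : (- (invmx (ulsubmx Q) *m ursubmx Q))^T = - (dlsubmx Q *m invmx (ulsubmx Q)).
  by rewrite linearN /= trmx_mul trmx_inv t11 posdef_tr_ursubmx.
rewrite !mulNmx mulmxKV // addNr mul0mx add0r.
by rewrite addrC.
Qed.

(* The block upper triangular factor of [Q] whose inverse is
   [row_mx (C_inf Q) (D_inf Q)]. *)
Definition sqrt_factor Q : 'M[R]_(k1 + k2) :=
  block_mx (sqrtm (Q11 Q)) (invmx (sqrtm (Q11 Q)) *m Q12 Q) 0 (sqrtm (Defs.Schur Q)).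

Lemma sqrt_factorP Q : posdef Q -> (sqrt_factor Q)^T *m sqrt_factor Q = Q.
Proof.
move=> pQ; have [p1 e1] := sqrtmP (posdef_ulsubmx pQ).
have [p2 e2] := sqrtmP (posdef_Schur pQ).
have u1 := posdef_unit p1; have [t1 _] := p1; have [t2 _] := p2.
rewrite /sqrt_factor tr_block_mx mulmx_block trmx_mul trmx_inv /Q11 /Q12 t1 t2.
rewrite trmx0 !mul0mx !mulmx0 !addr0 e1 mulKVmx // (posdef_tr_ursubmx pQ) mulmxKV //.
rewrite e2 mulmxA -(mulmxA (dlsubmx Q)) -invmx_mul // e1.
by rewrite /Defs.Schur /Q22 /Q21 /Q11 /Q12 addrC subrK submxK.
Qed.

Lemma invmx_sqrt_factor Q : posdef Q ->
  invmx (sqrt_factor Q) = row_mx (C_inf Q) (D_inf Q).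
Proof.
move=> pQ; have [p1 e1] := sqrtmP (posdef_ulsubmx pQ).
have [p2 e2] := sqrtmP (posdef_Schur pQ).
have u1 := posdef_unit p1; have u2 := posdef_unit p2.
have i1 : invmx (Q11 Q) = invmx (sqrtm (Q11 Q)) *m invmx (sqrtm (Q11 Q)).
  by rewrite -invmx_mul // e1.
have UL : sqrt_factor Q *m row_mx (C_inf Q) (D_inf Q) = 1%:M.
  rewrite mul_mx_row /sqrt_factor /C_inf /D_inf !mul_block_col !mulmx0 !mul0mx addr0 add0r.
  rewrite add0r !mulmxV // mulmxN i1 !mulmxA mulmxV // mul1mx addNr.
  by rewrite -block_mxEh -scalar_mx_block.
have [uU _] := mulmx1_unit UL.
by rewrite -[RHS](mulKmx uU) UL mulmx1.
Qed.

(** Since [D_inf] maps [Schur^(1/2) g] to [- B_inf g], the terms in [B_inf g] are exactly what the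
    translation by [c = Schur^(1/2) g] produces. *)
Lemma W_gammaE Q (s alpha : R) g z : posdef Q ->
  W_gamma Q s alpha g z =
  rlaw (expR (2 * alpha * k2%:R)) (alpha / s ^+ 2) (invmx (sqrt_factor Q)) (sqrtm (Defs.Schur Q) *m g) z.
Proof.
move=> pQ; rewrite (invmx_sqrt_factor pQ) /rlaw mul_row_col.
have [p2 _] := sqrtmP (posdef_Schur pQ); have u2 := posdef_unit p2.
have Dg : D_inf Q *m (sqrtm (Defs.Schur Q) *m g) = - (B_inf Q *m g).
  rewrite mulmxA /D_inf /B_inf !mul_col_mx opp_col_mx; congr col_mx.
    by rewrite !mulNmx -(mulmxA _ _ (sqrtm _)) mulVmx // mulmx1.
  by rewrite mulVmx // mulNmx !mul1mx opprK.
have hE : (1 + expR (2 * alpha * k2%:R) *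
    expR (- (alpha * enorm (dsubmx z + sqrtm (Defs.Schur Q) *m g) ^+ 2 / s ^+ 2)))^-1 =
  shrink (expR (2 * alpha * k2%:R)) (alpha / s ^+ 2) (nsq (dsubmx z + sqrtm (Defs.Schur Q) *m g)).
  set v := dsubmx z + _; have -> // : alpha * enorm v ^+ 2 / s ^+ 2 = alpha / s ^+ 2 * nsq v.
  by rewrite /enorm sqr_sqrtr ?nsq_ge0 // mulrAC.
rewrite /rmap mulmxBr -scalemxAr mulmxDr Dg opprK /W_gamma hE.
by rewrite -addrA [LHS]addrC -addrA.
Qed.

End block_posdef.

Lemma chol_ursubmx (R : realType) k1 k2 (A : 'M[R]_(k1 + k2)) : ursubmx (chol A) = 0.
Proof.
apply/matrixP => i j; rewrite !mxE; apply: chol_lower.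
by rewrite /= (leq_trans (ltn_ord i)) // leq_addr.
Qed.

Lemma ublock_unit (R : realType) k1 k2 (U : 'M[R]_(k1 + k2)) : dlsubmx U = 0 ->
  U \in unitmx -> ulsubmx U \in unitmx /\ drsubmx U \in unitmx.
Proof.
move=> U0; rewrite -{1}[U]submxK U0 !unitmxE det_ublock unitrM.
by move/andP.
Qed.

(* A Cholesky factor of the limit differs from [sqrt_factor Q] by an orthogonal
   matrix, which is absorbed in the approximating factors. *)
Lemma factor_sequence (R : realType) k1 k2 (M_ : nat -> 'M[R]_(k1 + k2)) Q N :
  posdef Q -> (forall n, (N <= n)%N -> posdef (M_ n)) -> mcvg M_ Q ->
  exists U_ : nat -> 'M[R]_(k1 + k2), mcvg U_ (sqrt_factor Q) /\
    forall n, (N <= n)%N -> (U_ n)^T *m U_ n = M_ n /\ dlsubmx (U_ n) = 0.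
Proof.
move=> pQ pM cM; pose V := (chol Q)^T.
have VV : V^T *m V = Q by rewrite trmxK cholP.
have uQ := posdef_unit pQ.
have uV : V \in unitmx by move: uQ; rewrite -VV unitmx_mul => /andP[].
pose W := sqrt_factor Q *m invmx V.
have OO : W^T *m W = 1%:M.
  rewrite trmx_mul mulmxA -(mulmxA _ _ (sqrt_factor Q)) sqrt_factorP // -[X in _ *m X *m _]VV.
  have uVT : V^T \in unitmx by rewrite unitmx_tr.
  by rewrite trmx_inv (mulKmx uVT); exact: mulmxV.
have OV : W *m V = sqrt_factor Q by rewrite mulmxKV.
have dlV (A : 'M[R]_(k1 + k2)) : dlsubmx (chol A)^T = 0.
  by rewrite -trmx_ursub chol_ursubmx trmx0.
(* [W V] and [V] are block upper triangular and the upper left block of [V] is invertible, so [W]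
   has the same shape and the rotated factors keep it. *)
have O0 : dlsubmx W = 0.
  have [u1 _] := ublock_unit (dlV Q) uV.
  have : dlsubmx (W *m V) = 0 by rewrite OV block_mxKdl.
  rewrite -{1}[W]submxK -{1}[V]submxK mulmx_block block_mxKdl dlV mulmx0 addr0.
  by move/(congr1 (mulmxr (invmx (ulsubmx V)))); rewrite /= mulmxK // mul0mx.
exists (fun n => W *m (chol (M_ n))^T); split.
  by rewrite -OV; apply: mcvgM; [exact: mcvg_cst|apply: mcvg_tr; exact: mcvg_chol].
move=> n Nn; split.
  by rewrite trmx_mul trmxK mulmxA -(mulmxA _ W^T) OO mulmx1; exact/cholP/pM.
by rewrite -[W]submxK -[(chol _)^T]submxK mulmx_block block_mxKdl dlV O0 mul0mx mulmx0 addr0.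
Qed.

Section estimator.
Variables (R : realType) (k1 k2 n : nat) (X : 'M[R]_(n, k1 + k2)) (s alpha : R).
Variable U : 'M[R]_(k1 + k2).
Local Notation r := (Num.sqrt (n%:R : R)).
Hypotheses (n0 : (0 < n)%N) (uU : U \in unitmx) (U0 : dlsubmx U = 0).
Hypothesis XU : X^T *m X = n%:R *: (U^T *m U).

Let r0 : r != 0. Proof. by rewrite gt_eqF // sqrtr_gt0 ltr0n. Qed.
Let rr : r * r = n%:R. Proof. by rewrite -expr2 sqr_sqrtr // ler0n. Qed.
Let nr : n%:R / r = r. Proof. by rewrite -{1}rr mulfK. Qed.
Let uUT : U^T \in unitmx. Proof. by rewrite unitmx_tr. Qed.

(* The standardized error [sqrt n * U (betaU - beta)] as a function of the
   disturbance [u]. *)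
Definition ols_noise : 'M[R]_(k1 + k2, n) := r^-1 *: (invmx U^T *m X^T).

Lemma ols_noise_orthonormal : ols_noise *m ols_noise^T = 1%:M.
Proof.
rewrite /ols_noise linearZ /= -scalemxAl -scalemxAr scalerA trmx_mul trmxK.
rewrite mulmxA -(mulmxA _ X^T) XU -scalemxAr -scalemxAl scalerA.
rewrite mulKmx // trmx_inv trmxK mulmxV // -invfM rr mulVf ?scale1r //.
by rewrite pnatr_eq0 -lt0n.
Qed.

Section fixed_data.
Variables (beta : 'cV[R]_(k1 + k2)) (u : 'cV[R]_n).
(** This is [sqrt n * U betaU]: in these coordinates the norm of [X b] becomes the Euclidean
    norm. *)
Let x := U *m (r *: beta) + ols_noise *m u.
Let Y := X *m beta + u.

Let XY : X^T *m Y = r *: (U^T *m x).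
Proof.
rewrite /x /ols_noise !mulmxDr mulmxA XU -scalemxAl scalerDr; congr (_ + _).
  by rewrite -!scalemxAr scalerA rr mulmxA.
by rewrite -scalemxAl -scalemxAr scalerA divff // scale1r !mulmxA mulmxV // mul1mx.
Qed.

Let uXX : X^T *m X \in unitmx.
Proof. by rewrite XU unitmxZ ?unitmx_mul ?uUT // unitfE pnatr_eq0 -lt0n. Qed.

Lemma betaUE : betaU X Y = r^-1 *: (invmx U *m x).
Proof.
rewrite /betaU -mulmxA -[RHS](mulKmx uXX) XY XU; congr (_ *m _).
by rewrite -scalemxAl -scalemxAr mulmxA -(mulmxA _ U) mulmxV // mulmx1 scalerA nr.
Qed.

(** The first block row of [U^T] is [(U11^T, 0)], so the normal equations of the restricted model
    involve only [U11] and the first block of [x]. *)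
Lemma U_betaRE : U *m betaR X Y = r^-1 *: col_mx (usubmx x) 0.
Proof.
have [u1 _] := ublock_unit U0 uU.
have UE : U = block_mx (ulsubmx U) (ursubmx U) 0 (drsubmx U) by rewrite -U0 submxK.
have XX1 : (X1 X)^T *m X1 X = n%:R *: ((ulsubmx U)^T *m ulsubmx U).
  have -> : (X1 X)^T *m X1 X = ulsubmx (X^T *m X).
    by rewrite -{3 4}[X]hsubmxK tr_row_mx mul_col_row block_mxKul.
  have -> : ulsubmx (X^T *m X) = n%:R *: ulsubmx (U^T *m U).
    by rewrite XU; apply/matrixP => i j; rewrite !mxE.
  by rewrite {1 2}UE tr_block_mx mulmx_block !block_mxKul trmx0 mul0mx addr0.
have XY1 : (X1 X)^T *m Y = r *: ((ulsubmx U)^T *m usubmx x).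
  have -> : (X1 X)^T *m Y = usubmx (X^T *m Y).
    by rewrite -{2}[X]hsubmxK tr_row_mx mul_col_mx col_mxKu.
  rewrite XY linearZ /= -{1}[x]vsubmxK {1}UE tr_block_mx mul_block_col trmx0 mul0mx addr0.
  by rewrite col_mxKu.
have uX1 : (X1 X)^T *m X1 X \in unitmx.
  by rewrite XX1 unitmxZ ?unitmx_mul ?unitmx_tr ?u1 // unitfE pnatr_eq0 -lt0n.
have -> : betaR X Y = col_mx (r^-1 *: (invmx (ulsubmx U) *m usubmx x)) 0.
  rewrite /betaR -mulmxA XY1; congr col_mx.
  rewrite -[RHS](mulKmx uX1) XX1; congr (_ *m _).
  by rewrite -scalemxAl -scalemxAr mulmxA -(mulmxA _ (ulsubmx U)) mulmxV // mulmx1 scalerA nr.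
rewrite {1}UE mul_block_col !mulmx0 mul0mx !addr0 -scalemxAr mulKVmx //.
by rewrite scale_col_mx scaler0.
Qed.

(** [X^T X = n U^T U] turns the distance between the two fits into the norm of the second block of
    [x]; the rest is [1 - 1 / (1 + q / p) = 1 / (1 + p / q)]. *)
Lemma lambda_hatE : 1 - lambda_hat X s alpha Y =
  shrink (expR (2 * alpha * k2%:R)) (alpha / s ^+ 2) (nsq (dsubmx x)).
Proof.
have E : enorm (X *m betaR X Y - X *m betaU X Y) ^+ 2 = nsq (dsubmx x).
  rewrite /enorm sqr_sqrtr ?nsq_ge0 // -mulmxBr -/(nsq _).
  rewrite nsqE trmx_mul mulmxA -(mulmxA _ X^T) XU -scalemxAr -scalemxAl scalemxE.
  rewrite mulmxA -trmx_mul -mulmxA -nsqE mulmxBr U_betaRE betaUE -scalemxAr mulKVmx //.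
  rewrite -scalerBr -{2}[x]vsubmxK opp_col_mx add_col_mx subrr sub0r nsqZ nsq_col_mx.
  rewrite {1}/nsq big1 ?add0r; last by move=> i _; rewrite mxE expr0n.
  rewrite -scaleN1r nsqZ sqrrN expr1n mul1r mulrA exprVn expr2 rr divff ?mul1r //.
  by rewrite pnatr_eq0 -lt0n.
rewrite /lambda_hat E /shrink expRN; set p := expR _.
have p0 : 0 < p by exact: expR_gt0.
rewrite [alpha * _ / _]mulrAC expRN; set q := expR _.
have q0 : 0 < q by exact: expR_gt0.
by field; rewrite !gt_eqF ?addr_gt0 ?mulr_gt0.
Qed.

(* In the coordinates [x = sqrt n * U b], imposing the restriction on the least
   squares estimate replaces the second block of [x] by [0], so averaging acts on
   this block alone, as the radial map. *)
Lemma beta_tildeE : r *: (beta_tilde X s alpha Y - beta) =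
  rlaw (expR (2 * alpha * k2%:R)) (alpha / s ^+ 2) (invmx U) (r *: dsubmx (U *m beta))
    (ols_noise *m u).
Proof.
rewrite -[LHS](mulKmx uU) /rlaw; congr (_ *m _).
set z := ols_noise *m u; set c := r *: dsubmx _.
have dx : dsubmx x = dsubmx z + c by rewrite /x linearD /= -scalemxAr linearZ /= addrC.
have ux : usubmx x = usubmx z + r *: usubmx (U *m beta).
  by rewrite /x linearD /= -scalemxAr linearZ /= addrC.
rewrite -scalemxAr mulmxBr scalerBr /beta_tilde mulmxDr -!scalemxAr U_betaRE.
rewrite betaUE -scalemxAr mulKVmx // scalerDr ![r *: (_ *: _)]scalerA.
rewrite !scalerA ![r * _ / r]mulrAC divff // !mul1r lambda_hatE dx /rmap.
have -> : r *: (U *m beta) = col_mx (r *: usubmx (U *m beta)) c.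
  by rewrite -{1}[U *m beta]vsubmxK scale_col_mx.
rewrite -{2}[x]vsubmxK dx !scale_col_mx scaler0 opp_col_mx !add_col_mx add0r.
congr (col_mx _ _); rewrite -scalerDl -[X in shrink _ _ (nsq X)]dx -lambda_hatE.
by rewrite [_ + (1 - _)]addrC subrK scale1r ux addrK.
Qed.

End fixed_data.
End estimator.

(** [F] bounds the squared operator norm. Once [F (K - K_k) <= 1 / (4 C)], one has [|b|^2 <= C |K
    b|^2 <= 2 C |K_k b|^2 + |b|^2 / 2], hence [|b|^2 <= 4 C |K_k b|^2]. *)
Lemma cvgy_nsq_mulmx (R : realType) m (K_ : nat -> 'M[R]_m) K (b_ : nat -> 'cV[R]_m) :
  K \in unitmx -> mcvg K_ K -> enorm (b_ k) @[k --> \oo] --> +oo ->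
  enorm (K_ k *m b_ k) @[k --> \oo] --> +oo.
Proof.
move=> uK cK cb; pose F (A : 'M[R]_m) : R := \sum_i (\sum_j `|A i j|) ^+ 2.
have FM (A : 'M[R]_m) v : nsq (A *m v) <= F A * nsq v.
  rewrite /F mulr_suml; apply: ler_sum => i _.
  have le1 : `|(A *m v) i 0| <= (\sum_j `|A i j|) * enorm v.
    rewrite mxE mulr_suml; apply: (le_trans (ler_norm_sum _ _ _)); apply: ler_sum => j _.
    rewrite normrM ler_wpM2l //; rewrite -[`|v j 0|]sqrtr_sqr.
    rewrite ler_wsqrtr // (bigD1 j) //= lerDl; apply: sumr_ge0 => l _; exact: sqr_ge0.
  rewrite -[nsq v]sqr_sqrtr ?nsq_ge0 // -/(enorm v) -exprMn -[X in X <= _]real_normK ?num_real //.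
  by rewrite lerXn2r ?nnegrE // mulr_ge0 ?sqrtr_ge0 // sumr_ge0.
have F0 (A : 'M[R]_m) : 0 <= F A by apply: sumr_ge0 => i _; exact: sqr_ge0.
have cF : F (K - K_ k) @[k --> \oo] --> 0.
  have -> : (0 : R) = F (K - K).
    by rewrite subrr /F big1 // => i _; rewrite big1 ?expr0n // => j _; rewrite mxE normr0.
  have c : mcvg (fun k => K - K_ k) (K - K) by apply: mcvgB => //; exact: mcvg_cst.
  apply: cvg_sumR => i; rewrite [X in X --> _](_ : _ = (fun k => (\sum_j `|(K - K_ k) i j|) * (\sum_j `|(K - K_ k) i j|)) @ \oo) //.
  by rewrite expr2; apply: cvgM; apply: cvg_sumR => j; apply: cvg_norm; exact: c.
pose C := F (invmx K) + 1; have C0 : 0 < C by rewrite ltr_wpDl.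
have bK k : nsq (b_ k) <= C * nsq (K *m b_ k).
  rewrite -{1}[b_ k](mulKmx uK); apply: (le_trans (FM _ _)).
  by rewrite ler_wpM2r ?nsq_ge0 // lerDl.
apply/cvgryPge => A; near=> k.
have h1 : F (K - K_ k) <= (4 * C)^-1.
  near: k; have /cvgrPdist_le/(_ (4 * C)^-1) := cF; rewrite invr_gt0 mulr_gt0 //.
  by move=> /(_ isT); apply: filterS => k; rewrite sub0r normrN ger0_norm.
(* The [+ 1] again makes the norm of [b_ k] at least 1, so that its square dominates it. *)
have h2 : 4 * C * (`|A| + 1) ^+ 2 + 1 <= enorm (b_ k).
  by near: k; move/cvgryPge : cb; exact.
have h3 : nsq (K *m b_ k) <= 2 * nsq (K_ k *m b_ k) + 2 * nsq ((K - K_ k) *m b_ k).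
  rewrite mulmxBl; set p := K *m _; set q := K_ k *m _.
  rewrite /nsq !mulr_sumr -big_split /=; apply: ler_sum => i _.
  rewrite addmxE oppmxE; have := sqr_ge0 (2 * q i 0 - p i 0); rewrite !expr2; nra.
have h4 := FM (K - K_ k) (b_ k); have h5 := bK k.
have h6 : nsq (b_ k) <= 4 * C * nsq (K_ k *m b_ k).
  have n0 := nsq_ge0 (b_ k).
  have h7 : nsq ((K - K_ k) *m b_ k) <= (4 * C)^-1 * nsq (b_ k).
    by apply: (le_trans h4); rewrite ler_wpM2r.
  have h8 : C * (4 * C)^-1 = 4^-1 by field; rewrite gt_eqF.
  have h9 : C * nsq (K *m b_ k) <= C * (2 * nsq (K_ k *m b_ k) + 2 * ((4 * C)^-1 * nsq (b_ k))).
    by rewrite ler_pM2l //; apply: (le_trans h3); rewrite lerD2l ler_pM2l.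
  have : C * (2 * nsq (K_ k *m b_ k) + 2 * ((4 * C)^-1 * nsq (b_ k))) =
     2 * C * nsq (K_ k *m b_ k) + 2 * (C * (4 * C)^-1) * nsq (b_ k) by ring.
  by rewrite h8 => e; lra.
have e1 : 1 <= enorm (b_ k).
  by apply: le_trans h2; rewrite lerDr !mulr_ge0 // ?ltW // addr_ge0.
have h10 : enorm (b_ k) <= nsq (b_ k).
  by rewrite -[nsq _]sqr_sqrtr ?nsq_ge0 // -/(enorm (b_ k)) expr2 ler_peMl // sqrtr_ge0.
have h11 : (`|A| + 1) ^+ 2 <= nsq (K_ k *m b_ k).
  rewrite -(ler_pM2l (_ : 0 < 4 * C)) ?mulr_gt0 //; lra.
apply: (le_trans (ler_norm A)); apply: le_trans (_ : `|A| + 1 <= _); first by rewrite lerDl.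
rewrite -[X in X <= _]ger0_norm ?addr_ge0 // -sqrtr_sqr ler_wsqrtr //.
Unshelve. all: by end_near.
Qed.

Section gauss_law.
Variables (R : realType) (kap a s : R) (k1 k2 : nat).
Hypotheses (kap0 : 0 < kap) (a0 : 0 < a) (s0 : s != 0) (k20 : (0 < k2)%N).
Variables (U : 'M[R]_(k1 + k2)) (c : 'cV[R]_k2).
Hypothesis uU : U \in unitmx.

(** Orthonormal rows turn the [n] disturbances into [k1 + k2] independent ones of the same variance.
    [N] is [ols_noise] for the estimator and the identity for the limit law. *)
Lemma gauss_prob_rlaw n (N : 'M[R]_(k1 + k2, n)) (A : set (Rn R (k1 + k2))) :
  N *m N^T = 1%:M -> measurable A ->
  gauss_prob s [set u : Rn R n | A (ctup (rlaw kap a (invmx U) c (N *m tcol u)))] =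
  (\int[lebn R (k1 + k2)]_t ((\1_A t : R) * fdens kap a s U c (tcol t))%:E)%E.
Proof.
move=> NN mA; pose F (v : 'cV[R]_(k1 + k2)) : \bar R := ((\1_A (ctup v) : R)%:E).
have mI : measurable_fun setT (fun t : Rn R (k1 + k2) => ((\1_A t : R)%:E)).
  by apply/measurable_EFinP; exact: measurable_indic.
have mF : mcol F by exact: (mcol_measurable mI).
have F0 v : (0 <= F v)%E by rewrite lee_fin.
pose G (z : 'cV[R]_(k1 + k2)) := F (rlaw kap a (invmx U) c z).
have mG : mcol G by exact: (mcol_comp mF (mmap_rlaw a kap0 _ c)).
have G0 z : (0 <= G z)%E by exact: F0.
have -> : gauss_prob s [set u : Rn R n | A (ctup (rlaw kap a (invmx U) c (N *m tcol u)))] =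
    leb_int (fun u : Rn R n => G (N *m tcol u) * (gpdf s (tcol u))%:E)%E.
  congr leb_int; apply/funext => u; rewrite /G /F -EFinM; congr ((_ * _)%:E).
  by apply: eq_bigr => i _; rewrite mxE.
rewrite leb_intE; last 2 first.
- apply: emeasurable_funM; first exact: (mcol_comp mG (mmap_mulmx N (@mmap_id R n))).
  by apply/measurable_EFinP; exact: (mcol_gpdf s (@mmap_id R n)).
- by move=> u; rewrite mule_ge0 // lee_fin gpdf_ge0.
have := gauss_marginal s0 NN mG G0; rewrite {1}/colint => ->.
have := colint_rlaw s kap0 a0 k20 c uU mF F0; rewrite -/G => ->.
by apply: eq_integral => t _; rewrite /F tcolK EFinM.
Qed.

(** The mass 1 required by Scheffe's lemma is inherited from the Gaussian, with the whole space as
    [A]. *)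
Lemma colint_fdens : (\int[lebn R (k1 + k2)]_t (fdens kap a s U c (tcol t))%:E = 1)%E.
Proof.
have NN : (1%:M : 'M[R]_(k1 + k2)) *m 1%:M^T = 1%:M by rewrite trmx1 mulmx1.
have := gauss_prob_rlaw NN (@measurableT _ (Rn R (k1 + k2))).
under eq_integral do rewrite indicE in_setT mul1r.
move=> <-; rewrite -(colint_gpdf (k1 + k2) s0) colint_leb_int; last 2 first.
- by apply/measurable_EFinP; exact: (mcol_gpdf s (@mmap_id R (k1 + k2))).
- by move=> v; rewrite lee_fin gpdf_ge0.
congr leb_int; apply/funext => u; congr EFin.
rewrite indicE mem_set // mul1r.
by apply: eq_bigr => i _; rewrite mxE.
Qed.

End gauss_law.

(** Puts the density into the form reached in [cvg_fdens_infty]: with [Q = U^T U] the quadratic form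
    is [|U t|^2] and the root of [det Q] is [|det U|]. *)
Lemma f_inf_infE (R : realType) k1 k2 (Q : 'M[R]_(k1 + k2)) s t : 0 < s -> posdef Q ->
  f_inf_inf Q s t = `|\det (sqrt_factor Q)| * gpdf s (sqrt_factor Q *m tcol t).
Proof.
move=> s0 pQ; rewrite /f_inf_inf gpdfE ?gt_eqF //.
have dQ : \det Q = \det (sqrt_factor Q) ^+ 2.
  by rewrite -{1}(sqrt_factorP pQ) det_mulmx det_tr expr2.
rewrite dQ sqrtr_sqr -mulrA; congr (_ * (_ * expR _)).
  set v := s ^+ 2 * pi *+ 2; have v0 : 0 <= v by rewrite mulrn_wge0 // mulr_ge0 ?sqr_ge0 // pi_ge0.
  rewrite /normal_peak -/v exprVn -{1}(sqr_sqrtr v0) -exprM mulnC exprM sqrtr_sqr.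
  by rewrite ger0_norm // exprn_ge0 // sqrtr_ge0.
by rewrite nsqE trmx_mul mulmxA -(mulmxA _ _^T) sqrt_factorP // mulNr.
Qed.

Lemma posdef_scale (R : realType) m (A : 'M[R]_m) (x : R) : 0 < x -> posdef A -> posdef (x *: A).
Proof.
move=> x0 [As pos]; split; first by rewrite linearZ /= As.
by move=> v v0; rewrite -scalemxAr -scalemxAl scalemxE mulr_gt0 // pos.
Qed.

Theorem theorem8 (R : realType) (k1 k2 : nat) (X : forall n : nat, 'M[R]_(n, k1 + k2))
  (Q : 'M[R]_(k1 + k2)) (s alpha : R) (beta : nat -> 'cV[R]_(k1 + k2)) :
  (0 < k1)%N -> (0 < k2)%N -> 0 < s -> 0 < alpha ->
  (forall n, (k1 + k2 <= n)%N -> \rank (X n) = (k1 + k2)%N) ->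
  ((n%:R^-1 *: ((X n)^T *m X n)) @[n --> \oo] --> Q) ->
  posdef Q ->
  (* case 1: || sqrt n beta_2^(n) || -> oo *)
  ((enorm (Num.sqrt (n%:R) *: dsubmx (beta n)) @[n --> \oo] --> +oo) ->
    forall fn : nat -> Rn R (k1 + k2) -> R,
    (forall n, (k1 + k2 <= n)%N -> is_density (law_n (X n) s alpha (beta n)) (fn n)) ->
    (leb_int (fun t => (`|fn n t - f_inf_inf Q s t|)%:E) @[n --> \oo] --> 0%E) /\
    (forall eps : R, 0 < eps -> \forall n \near \oo,
       forall A : set (Rn R (k1 + k2)), measurable A ->
       (`| law_n (X n) s alpha (beta n) A
           - leb_int (fun t => ((\1_A t : R) * f_inf_inf Q s t)%:E) | < eps%:E)%E))
  /\
  (* case 2: sqrt n beta_2^(n) -> gamma *)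
  (forall gamma : 'cV[R]_k2,
    (Num.sqrt (n%:R) *: dsubmx (beta n) @[n --> \oo] --> gamma) ->
    forall (fn : nat -> Rn R (k1 + k2) -> R) (finf : Rn R (k1 + k2) -> R),
    (forall n, (k1 + k2 <= n)%N -> is_density (law_n (X n) s alpha (beta n)) (fn n)) ->
    is_density (law_inf_gamma Q s alpha gamma) finf ->
    (leb_int (fun t => (`|fn n t - finf t|)%:E) @[n --> \oo] --> 0%E) /\
    (forall eps : R, 0 < eps -> \forall n \near \oo,
       forall A : set (Rn R (k1 + k2)), measurable A ->
       (`| law_n (X n) s alpha (beta n) A - law_inf_gamma Q s alpha gamma A | < eps%:E)%E)).
Proof.
move=> k10 k20 s0 alpha0 rkX cX pQ.
pose kap := expR (2 * alpha * k2%:R); pose a := alpha / s ^+ 2.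
have kap0 : 0 < kap by exact: expR_gt0.
have a0 : 0 < a by rewrite divr_gt0 // exprn_gt0.
have sn0 : s != 0 by rewrite gt_eqF.
have n_gt0 n : (k1 + k2 <= n)%N -> (0 < n)%N.
  by apply: leq_trans; rewrite addn_gt0 k10.
have pM n : (k1 + k2 <= n)%N -> posdef (n%:R^-1 *: ((X n)^T *m X n)).
  move=> kn; apply: posdef_scale; first by rewrite invr_gt0 ltr0n n_gt0.
  by rewrite -{2}[X n]trmxK; apply: posdef_gram; rewrite /row_free mxrank_tr rkX.
have [U_ [cU PU]] := factor_sequence pQ pM (cvg_mcvg cX).
pose U := sqrt_factor Q.
have uU : U \in unitmx.
  by have := posdef_unit pQ; rewrite -(sqrt_factorP pQ) unitmx_mul => /andP[].
pose c_ n := Num.sqrt (n%:R) *: dsubmx (U_ n *m beta n).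
pose g_ n (t : Rn R (k1 + k2)) := fdens kap a s (U_ n) (c_ n) (tcol t).
have mfd V c : measurable_fun setT (fun t : Rn R (k1 + k2) => fdens kap a s V c (tcol t)).
  exact: mcol_fdens.
have mg_ n : measurable_fun setT (g_ n) by exact: mfd.
have uU_ n : (k1 + k2 <= n)%N -> U_ n \in unitmx.
  move=> kn; have := posdef_unit (pM n kn); have [<- _] := PU n kn.
  by rewrite unitmx_mul => /andP[].
have g_0 n t : 0 <= g_ n t by exact: fdens_ge0.
have law_g n A : (k1 + k2 <= n)%N -> measurable A -> law_n (X n) s alpha (beta n) A =
    (\int[lebn R (k1 + k2)]_t ((\1_A t : R) * g_ n t)%:E)%E.
  move=> kn mA; have [UU U0] := PU n kn.
  have XU : (X n)^T *m X n = n%:R *: ((U_ n)^T *m U_ n).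
    by rewrite UU scalerA divff ?scale1r // pnatr_eq0 -lt0n n_gt0.
  have NN := ols_noise_orthonormal (n_gt0 _ kn) (uU_ _ kn) XU.
  rewrite -(gauss_prob_rlaw kap0 a0 sn0 k20 (c_ n) (uU_ _ kn) NN mA).
  congr gauss_prob; apply/funext => u /=.
  by rewrite (beta_tildeE _ _ (n_gt0 _ kn) (uU_ _ kn) U0 XU).
have g_1 n : (k1 + k2 <= n)%N -> (\int[lebn R (k1 + k2)]_t (g_ n t)%:E = 1)%E.
  by move=> kn; exact/colint_fdens/uU_.
have U0 : dlsubmx U = 0 by rewrite block_mxKdl.
have [_ uK] := ublock_unit U0 uU.
have cK : mcvg (fun n => drsubmx (U_ n)) (drsubmx U).
  exact: (mcvg_rsubmx (mcvg_dsubmx cU)).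
(* The lower left block of [U_ n] vanishes, so the shift depends only on the second block of
   [beta n]; the assumptions on [sqrt n beta_2] enter here. *)
have c_E n : (k1 + k2 <= n)%N -> c_ n = drsubmx (U_ n) *m (Num.sqrt (n%:R) *: dsubmx (beta n)).
  move=> kn; have [_ Un0] := PU n kn; rewrite /c_ -scalemxAr; congr (_ *: _).
  by rewrite -{1}[U_ n]submxK -{1}[beta n]vsubmxK mul_block_col col_mxKd Un0 mul0mx add0r.
split.
- move=> binf fn dfn.
  have cinf : enorm (c_ n) @[n --> \oo] --> +oo.
    have := cvgy_nsq_mulmx uK cK binf.
    by apply: cvg_trans; apply: near_eq_cvg; exists (k1 + k2)%N => // n /= kn; rewrite c_E.
  pose g t := f_inf_inf Q s t.
  have gE t : g t = `|\det U| * gpdf s (U *m tcol t) by exact: f_inf_infE.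
  have mg : measurable_fun setT g.
    have -> : g = (fun t => `|\det U| * gpdf s (U *m tcol t)) by exact/funext.
    apply: measurable_funM; first exact: measurable_cst.
    exact: (mcol_gpdf s (mmap_mulmx U (@mmap_id R (k1 + k2)))).
  have g0 t : 0 <= g t by rewrite gE mulr_ge0 // gpdf_ge0.
  pose P A := leb_int (fun t => ((\1_A t : R) * f_inf_inf Q s t)%:E).
  have Pg A : measurable A -> P A = (\int[lebn R (k1 + k2)]_t ((\1_A t : R) * g t)%:E)%E.
    move=> mA; rewrite /P leb_intE //; last by move=> t; rewrite lee_fin mulr_ge0 // g0.
    by apply/measurable_EFinP; apply: measurable_funM.
  have g1 : (\int[lebn R (k1 + k2)]_t (g t)%:E = 1)%E.
    have mgp : mcol (fun v : 'cV[R]_(k1 + k2) => (gpdf s v)%:E).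
      by apply/measurable_EFinP; exact: (mcol_gpdf s (@mmap_id R (k1 + k2))).
    have gp0 (v : 'cV[R]_(k1 + k2)) : (0 <= (gpdf s v)%:E)%E by rewrite lee_fin gpdf_ge0.
    have mUp : mcol (fun v : 'cV[R]_(k1 + k2) => (gpdf s (U *m v + 0))%:E).
      apply/measurable_EFinP.
      have mU := mmap_mulmx U (@mmap_id R (k1 + k2)).
      exact: (mcol_gpdf s (mmapD mU (@mmap_cst R (k1 + k2) _ 0))).
    rewrite -(colint_gpdf (k1 + k2) sn0) -(colint_affine 0 uU mgp gp0) -(colintZl mUp (fun v => gp0 _)) //.
    by apply: eq_integral => t _; rewrite gE EFinM addr0.
  have cg t : g_ n t @[n --> \oo] --> g t.
    by rewrite gE; exact: cvg_fdens_infty.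
  have dP : is_density P g by split.
  split.
    exact: (L1_convergence mg_ mg g_0 g0 law_g Pg g_1 g1 cg dfn dP).
  move=> eps e0; exact: (TV_convergence mg_ mg g_0 g0 law_g Pg g_1 g1 cg e0).
- move=> gamma cgam fn finf dfn dinf.
  (* The limit of the shifts, since the lower right block of [sqrt_factor Q] is the root of the
     Schur complement; it is also the shift found in [W_gammaE]. *)
  pose c := sqrtm (Defs.Schur Q) *m gamma.
  have cc : mcvg c_ c.
    have := mcvgM cK (cvg_mcvg cgam); rewrite {1}/U block_mxKdr => cKg i j.
    apply: cvg_trans (cKg i j); apply: near_eq_cvg; exists (k1 + k2)%N => // n /= kn.
    by rewrite c_E.
  pose g (t : Rn R (k1 + k2)) := fdens kap a s U c (tcol t).
  have g0 t : 0 <= g t by exact: fdens_ge0.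
  have Pg A : measurable A -> law_inf_gamma Q s alpha gamma A =
      (\int[lebn R (k1 + k2)]_t ((\1_A t : R) * g t)%:E)%E.
    move=> mA; have NN : (1%:M : 'M[R]_(k1 + k2)) *m 1%:M^T = 1%:M by rewrite trmx1 mulmx1.
    rewrite -(gauss_prob_rlaw kap0 a0 sn0 k20 c uU NN mA).
    by congr gauss_prob; apply/funext => u /=; rewrite mul1mx W_gammaE.
  have g1 : (\int[lebn R (k1 + k2)]_t (g t)%:E = 1)%E by exact: colint_fdens.
  have cg t : g_ n t @[n --> \oo] --> g t by exact: cvg_fdens.
  split.
    exact: (L1_convergence mg_ (mfd U c) g_0 g0 law_g Pg g_1 g1 cg dfn dinf).
  move=> eps e0; exact: (TV_convergence mg_ (mfd U c) g_0 g0 law_g Pg g_1 g1 cg e0).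
Qed.
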